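(* Let $\Delta=\{z\in\mathbb{C}:|z|<1\}$. There are no strongly tame discrete subsets in the complex manifold $X=\Delta\times\mathbb{C}$.
   Context: A discrete subset of a complex manifold $X$ is a subset without accumulation points in $X$. An automorphism of $X$ is a biholomorphic self-map of $X$. An infinite discrete subset $D\subset X$ is called strongly tame if for every injective map $f:D\to D$ there exists an automorphism $\phi$ of $X$ such that $\phi(x)=f(x)$ for all $x\in D$. *)

(* Defs.v *)
From Stdlib Require Import Reals.
From Stdlib Require Finite_sets.
From Coquelicot Require Import Coquelicot.

(* A complex manifold is given here as an open subset [X] of a complex normed
   module [U]; self-maps of [X] and of its subsets are represented by total
   functions on [U], whose values outside the relevant subset are ignored. *)

(* Complex Frechet differentiability at every point of [X]: the scalar field
   is [C_AbsRing], so the differential is C-linear. *)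
Definition holomorphic_on {U : NormedModule C_AbsRing} (X : U -> Prop)
    (F : U -> U) : Prop :=
  forall p : U, X p -> ex_filterdiff F (locally p).

Definition automorphism {U : NormedModule C_AbsRing} (X : U -> Prop)
    (F : U -> U) : Prop :=
  holomorphic_on X F /\ (forall p : U, X p -> X (F p)) /\
  exists G : U -> U,
    holomorphic_on X G /\ (forall p : U, X p -> X (G p)) /\
    (forall p : U, X p -> G (F p) = p) /\ (forall p : U, X p -> F (G p) = p).

Definition accumulation_point {U : UniformSpace} (D : U -> Prop) (p : U) : Prop :=
  forall V : U -> Prop, locally p V -> exists q : U, V q /\ D q /\ q <> p.

Definition discrete_subset {U : UniformSpace} (X D : U -> Prop) : Prop :=
  (forall p : U, D p -> X p) /\
  (forall p : U, X p -> ~ accumulation_point D p).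

Definition strongly_tame {U : NormedModule C_AbsRing} (X D : U -> Prop) : Prop :=
  discrete_subset X D /\
  ~ Finite_sets.Finite U D /\
  forall f : U -> U,
    (forall x : U, D x -> D (f x)) ->
    (forall x y : U, D x -> D y -> f x = f y -> x = y) ->
    exists phi : U -> U,
      automorphism X phi /\ (forall x : U, D x -> phi x = f x).

Definition C2 : NormedModule C_AbsRing :=
  prod_NormedModule C_AbsRing C_NormedModule C_NormedModule.

Definition disc (z : C) : Prop := (Cmod z < 1)%R.

Definition disc_times_C (p : C2) : Prop := disc (fst p).

(* Main.v *)
From Stdlib Require Import Reals Lra Lia List Classical ClassicalEpsilon.
From Stdlib Require Import FunctionalExtensionality PropExtensionality.
From Stdlib Require Finite_sets.
From Coquelicot Require Import Coquelicot.
Require Import Defs.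

(** Let [F] be an automorphism of [X = disc x C].  For fixed [z] the function
    [w => fst (F (z, w))] is entire and bounded by 1, hence constant by
    Liouville's theorem; so [F] covers an automorphism [a] of the disc
    ([automorphism_base]).  Strong tameness of [D] allows every permutation of
    finitely many points of [D] to be realised by an automorphism of [X], in
    particular it makes the automorphisms transitive on ordered pairs of
    distinct points of [D].  Both possible shapes of [D] are too rigid for that.

    If two points of [D] lie in one fibre [{z} x C], transitivity on pairs puts
    all of [D] in that fibre.  An automorphism preserving the fibre acts on it
    by an automorphism of [C], which is affine
    ([entire_automorphism_affine]), so one that fixes two points of [D] fixes
    the whole fibre and cannot exchange two other points of [D].

    Otherwise the first coordinates of the points of [D] are distinct.
    Automorphisms of the disc preserve the pseudo-hyperbolic distance
    [Cmod (mobius p z)] ([disc_automorphism_isometry]), so transitivity on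
    pairs makes the first coordinates pairwise equidistant; but the hyperbolic
    plane has no four pairwise equidistant points
    ([no_equilateral_quadruple]).

    All the function theory is drawn from one tool, the maximum modulus
    principle for functions that are continuous on a closed disc and complex
    differentiable inside it off a finite set.  Admitting the exceptional points
    matters: it applies the principle directly to difference quotients
    [(f z - f a) / (z - a)] extended continuously to [a], and no theorem on
    removable singularities has to come first.  Schwarz's lemma, Liouville's
    theorem and the affineness of automorphisms of [C] all bound such quotients.
    The maximum principle follows from the mean value property over circles, and
    this from Goursat's theorem in polar coordinates: if [f = u + iv] is complex
    differentiable off [z0], the form [v dr/r + u dt] is closed, its integral
    around [[s, r] x [0, 2 pi]] vanishes, and the two sides on which [t] is
    constant cancel by periodicity. *)

(** * Subdividing rectangles *)

Local Open Scope R_scope.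

Lemma nested_intervals_point (a l : nat -> R) :
  (forall n, 0 <= l n) -> (forall n, a n <= a (S n)) ->
  (forall n, a (S n) + l (S n) <= a n + l n) ->
  exists x, forall n, a n <= x <= a n + l n.
Proof.
  intros Hl Ha Hb.
  assert (Hmono : forall n k, a n <= a (n + k)%nat).
  { intros n k; induction k as [| k IH]; [rewrite Nat.add_0_r; lra |].
    rewrite Nat.add_succ_r; specialize (Ha (n + k)%nat); lra. }
  assert (Hanti : forall n k, a (n + k)%nat + l (n + k)%nat <= a n + l n).
  { intros n k; induction k as [| k IH]; [rewrite Nat.add_0_r; lra |].
    rewrite Nat.add_succ_r; specialize (Hb (n + k)%nat); lra. }
  assert (Hub : forall n m, a m <= a n + l n).
  { intros n m; destruct (Nat.le_ge_cases n m) as [H | H].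
    - replace m with (n + (m - n))%nat by lia.
      specialize (Hanti n (m - n)%nat); specialize (Hl (n + (m - n))%nat); lra.
    - replace n with (m + (n - m))%nat by lia.
      specialize (Hmono m (n - m)%nat); specialize (Hl (m + (n - m))%nat); lra. }
  destruct (completeness (fun y => exists n, y = a n)) as [x [Hx1 Hx2]].
  - exists (a O + l O); intros y [n ->]; apply Hub.
  - exists (a O), O; reflexivity.
  - exists x; intros n; split.
    + apply Hx1; exists n; reflexivity.
    + apply Hx2; intros y [m ->]; apply Hub.
Qed.

(** Compactness in the form of a bisection argument: a failing rectangle has a
    failing quarter, and the resulting nested sequence shrinks to a point near
    which [P] holds.  Rectangles keep the proportions [A : B], so that the
    square of the diameter stays comparable to the area. *)
Lemma rectangle_subdivision (A B : R) (P : R -> R -> R -> Prop) :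
  0 <= A -> 0 <= B ->
  (forall x y t, 0 < t ->
    P x y (t / 2) -> P (x + t / 2 * A) y (t / 2) ->
    P x (y + t / 2 * B) (t / 2) -> P (x + t / 2 * A) (y + t / 2 * B) (t / 2) ->
    P x y t) ->
  (forall x y, exists d, 0 < d /\ forall x' y' t, 0 < t < d ->
    x' <= x <= x' + t * A -> y' <= y <= y' + t * B -> P x' y' t) ->
  forall x y, P x y 1.
Proof.
  intros HA HB Hsub Hloc x0 y0; apply NNPP; intros Hneg.
  set (step := fun (p : R * R) (t : R) =>
    let (x, y) := p in
    if excluded_middle_informative (P x y (t / 2)) then
    if excluded_middle_informative (P (x + t / 2 * A) y (t / 2)) then
    if excluded_middle_informative (P x (y + t / 2 * B) (t / 2)) then
      (x + t / 2 * A, y + t / 2 * B)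
    else (x, y + t / 2 * B) else (x + t / 2 * A, y) else (x, y)).
  set (corner := fix corner (n : nat) : R * R :=
    match n with O => (x0, y0) | S n => step (corner n) ((/ 2) ^ n) end).
  assert (Hpos : forall n, 0 < (/ 2) ^ n) by (intros n; apply pow_lt; lra).
  assert (HS : forall n, (/ 2) ^ S n = (/ 2) ^ n / 2)
    by (intros n; simpl; field).
  assert (Hnot : forall n, ~ P (fst (corner n)) (snd (corner n)) ((/ 2) ^ n)).
  { intros n; induction n as [| n IH]; [exact Hneg |].
    intros Hp; apply IH; clear IH; revert Hp; rewrite HS.
    change (corner (S n)) with (step (corner n) ((/ 2) ^ n)).
    destruct (corner n) as [x y]; unfold step; simpl fst; simpl snd.
    destruct excluded_middle_informative as [H1 | H1]; [| tauto].
    destruct excluded_middle_informative as [H2 | H2]; [| tauto].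
    destruct excluded_middle_informative as [H3 | H3]; [| tauto].
    intros H4; apply Hsub; auto. }
  assert (Hstep : forall n,
    fst (corner n) <= fst (corner (S n)) /\
    fst (corner (S n)) + (/ 2) ^ S n * A <= fst (corner n) + (/ 2) ^ n * A /\
    snd (corner n) <= snd (corner (S n)) /\
    snd (corner (S n)) + (/ 2) ^ S n * B <= snd (corner n) + (/ 2) ^ n * B).
  { intros n; rewrite HS; specialize (Hpos n).
    change (corner (S n)) with (step (corner n) ((/ 2) ^ n)).
    destruct (corner n) as [x y]; unfold step; simpl fst; simpl snd.
    assert (0 <= (/ 2) ^ n * A) by nra. assert (0 <= (/ 2) ^ n * B) by nra.
    destruct excluded_middle_informative; [
    destruct excluded_middle_informative; [
    destruct excluded_middle_informative |] |]; simpl fst; simpl snd; lra. }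
  destruct (nested_intervals_point (fun n => fst (corner n)) (fun n => (/ 2) ^ n * A))
    as [x Hx]; try (intros n; apply Hstep).
  { intros n; specialize (Hpos n); nra. }
  destruct (nested_intervals_point (fun n => snd (corner n)) (fun n => (/ 2) ^ n * B))
    as [y Hy]; try (intros n; apply Hstep).
  { intros n; specialize (Hpos n); nra. }
  destruct (Hloc x y) as [d [Hd H]].
  destruct (pow_lt_1_zero (/ 2)) with (y := d) as [n Hn]; [| exact Hd |].
  { rewrite Rabs_pos_eq; lra. }
  apply (Hnot n), H; [| apply Hx | apply Hy].
  specialize (Hn n (Nat.le_refl n)); specialize (Hpos n).
  rewrite Rabs_pos_eq in Hn; lra.
Qed.

(** * Circulation of a closed form around a rectangle *)

(** The integral of [P dx + Q dy] around the boundary of [[a, b] x [c, d]],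
    counterclockwise. *)
Definition circulation (P Q : R -> R -> R) (a b c d : R) : R :=
  RInt (fun x => P x c) a b + RInt (fun y => Q b y) c d
  - RInt (fun x => P x d) a b - RInt (fun y => Q a y) c d.

Lemma differentiable_pt_lim_slices (f : R -> R -> R) (x y fx fy : R) :
  differentiable_pt_lim f x y fx fy ->
  continuous (fun u => f u y) x /\ continuous (fun v => f x v) y.
Proof.
  intros H.
  assert (Hc : continuity_2d_pt f x y)
   by (apply differentiable_continuity_pt; exists fx, fy; exact H).
  split; intros P [e He]; destruct (Hc e) as [d Hd]; exists d; intros u Hu;
    apply He; apply Hd; try exact Hu; rewrite Rminus_eq_0, Rabs_R0; apply cond_pos.
Qed.

Lemma circulation_subdivision (P Q : R -> R -> R) (a b m c d n : R) :
  a <= m <= b -> c <= n <= d ->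
  (forall x y, a <= x <= b -> c <= y <= d ->
    continuous (fun u => P u y) x /\ continuous (fun v => Q x v) y) ->
  circulation P Q a b c d =
  circulation P Q a m c n + circulation P Q m b c n
  + circulation P Q a m n d + circulation P Q m b n d.
Proof.
  intros Hm Hn Hc.
  assert (HP : forall y u v, c <= y <= d -> a <= u -> u <= v -> v <= b ->
    ex_RInt (fun x => P x y) u v).
  { intros y u v Hy H1 H2 H3; apply (ex_RInt_continuous (V := R_CompleteNormedModule)).
    intros z; rewrite Rmin_left, Rmax_right by lra; intros Hz; apply Hc; lra. }
  assert (HQ : forall x u v, a <= x <= b -> c <= u -> u <= v -> v <= d ->
    ex_RInt (fun y => Q x y) u v).
  { intros y u v Hy H1 H2 H3; apply (ex_RInt_continuous (V := R_CompleteNormedModule)).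
    intros z; rewrite Rmin_left, Rmax_right by lra; intros Hz; apply Hc; lra. }
  unfold circulation.
  rewrite <- (RInt_Chasles (fun x => P x c) a m b) by (apply HP; lra).
  rewrite <- (RInt_Chasles (fun x => P x d) a m b) by (apply HP; lra).
  rewrite <- (RInt_Chasles (fun y => Q a y) c n d) by (apply HQ; lra).
  rewrite <- (RInt_Chasles (fun y => Q b y) c n d) by (apply HQ; lra).
  unfold plus; simpl. ring.
Qed.

(** Comparing the integrals over opposite sides of a rectangle only requires the
    difference of the integrands to be nearly constant. *)
Lemma RInt_difference_bound (f g : R -> R) (a b k M : R) :
  a <= b ->
  (forall x, a <= x <= b -> continuous f x) ->
  (forall x, a <= x <= b -> continuous g x) ->
  (forall x, a <= x <= b -> Rabs (f x - g x - k) <= M) ->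
  Rabs (RInt f a b - RInt g a b - (b - a) * k) <= (b - a) * M.
Proof.
  intros Hab Hf Hg H.
  assert (If : ex_RInt f a b).
  { apply (ex_RInt_continuous (V := R_CompleteNormedModule)).
    intros z; rewrite Rmin_left, Rmax_right by lra; auto. }
  assert (Ig : ex_RInt g a b).
  { apply (ex_RInt_continuous (V := R_CompleteNormedModule)).
    intros z; rewrite Rmin_left, Rmax_right by lra; auto. }
  assert (Ik : ex_RInt (fun _ => k) a b) by apply ex_RInt_const.
  assert (Ifg := ex_RInt_minus f g a b If Ig).
  assert (I := ex_RInt_minus _ _ a b Ifg Ik).
  replace (RInt f a b - RInt g a b - (b - a) * k)
    with (RInt (fun x => minus (minus (f x) (g x)) k) a b).
  - apply abs_RInt_le_const; auto.
  - rewrite (RInt_minus (V := R_CompleteNormedModule)) by assumption.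
    rewrite (RInt_minus (V := R_CompleteNormedModule)) by assumption.
    rewrite RInt_const. reflexivity.
Qed.

(** Goursat's argument: the form is closed but its coefficients are merely
    differentiable, so Green's formula is not available.  Circulation is additive
    under subdivision, and on a small rectangle the linear parts of [P] and [Q]
    contribute opposite amounts, leaving an error that is small compared with the
    area. *)
Theorem closed_form_circulation (P Q : R -> R -> R) (a b c d : R) :
  a < b -> c < d ->
  (forall x y, a <= x <= b -> c <= y <= d -> exists px k qy,
    differentiable_pt_lim P x y px k /\ differentiable_pt_lim Q x y k qy) ->
  circulation P Q a b c d = 0.
Proof.
  intros Hab Hcd HD.
  assert (Hc : forall x y, a <= x <= b -> c <= y <= d ->
    continuous (fun u => P u y) x /\ continuous (fun v => Q x v) y).
  { intros x y Hx Hy; destruct (HD x y Hx Hy) as [px [k [qy [H1 H2]]]].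
    apply differentiable_pt_lim_slices in H1, H2; tauto. }
  set (A := b - a). set (B := d - c).
  assert (HA : 0 < A) by (unfold A; lra). assert (HB : 0 < B) by (unfold B; lra).
  assert (Hsmall : forall eps, 0 < eps -> Rabs (circulation P Q a b c d) <= eps).
  { intros eps He.
    cut ((fun x y t => a <= x -> x + t * A <= b -> c <= y -> y + t * B <= d ->
        Rabs (circulation P Q x (x + t * A) y (y + t * B)) <= t * t * eps) a c 1).
    { intros H; replace b with (a + 1 * A) by (unfold A; ring).
      replace d with (c + 1 * B) by (unfold B; ring).
      replace eps with (1 * 1 * eps) by ring.
      apply H; unfold A, B; lra. }
    apply rectangle_subdivision with (A := A) (B := B); try lra.
    - intros x y t Ht H1 H2 H3 H4 Hx1 Hx2 Hy1 Hy2.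
      assert (0 < t * A) by nra. assert (0 < t * B) by nra.
      rewrite (circulation_subdivision P Q x (x + t * A) (x + t / 2 * A)
        y (y + t * B) (y + t / 2 * B)); try lra.
      2: { intros u v Hu Hv; apply Hc; lra. }
      replace (x + t / 2 * A + t / 2 * A) with (x + t * A) in H2, H4 by field.
      replace (y + t / 2 * B + t / 2 * B) with (y + t * B) in H3, H4 by field.
      specialize (H1 ltac:(lra) ltac:(lra) ltac:(lra) ltac:(lra)).
      specialize (H2 ltac:(lra) ltac:(lra) ltac:(lra) ltac:(lra)).
      specialize (H3 ltac:(lra) ltac:(lra) ltac:(lra) ltac:(lra)).
      specialize (H4 ltac:(lra) ltac:(lra) ltac:(lra) ltac:(lra)).
      replace (t * t * eps) with (4 * (t / 2 * (t / 2) * eps)) by field.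
      apply Rabs_le_between in H1, H2, H3, H4. apply Rabs_le_between. lra.
    - intros x y.
      destruct (classic ((a <= x <= b) /\ (c <= y <= d))) as [[Hx Hy] | Hout].
      2: { exists 1; split; [lra |]; intros; exfalso; apply Hout; lra. }
      destruct (HD x y Hx Hy) as [px [k [qy [HP HQ]]]].
      (* On a rectangle of scale [t] the error is at most [4 e s^2], where
         s = t (A + B); this [e] makes that bound equal to [eps t^2]. *)
      set (e := eps / (4 * ((A + B) * (A + B)))).
      assert (Hs : 0 < (A + B) * (A + B)) by nra.
      assert (He' : 0 < e) by (apply Rdiv_lt_0_compat; lra).
      destruct (HP (mkposreal e He')) as [d1 H1].
      destruct (HQ (mkposreal e He')) as [d2 H2]; simpl in H1, H2.
      set (m := Rmin d1 d2).
      assert (Hm : 0 < m) by (apply Rmin_pos; apply cond_pos).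
      exists (m / (A + B)); split; [apply Rdiv_lt_0_compat; lra |].
      intros x' y' t [Ht Ht'] Hx' Hy' Ha Hb Hc' Hd.
      assert (Htm : t * (A + B) < m).
      { apply Rmult_lt_compat_r with (r := A + B) in Ht'; [| lra].
        unfold Rdiv in Ht'; rewrite Rmult_assoc, Rinv_l in Ht'; lra. }
      assert (0 < t * A) by nra. assert (0 < t * B) by nra.
      assert (Hm1 := Rmin_l d1 d2). assert (Hm2 := Rmin_r d1 d2). fold m in Hm1, Hm2.
      set (s := t * (A + B)) in *.
      assert (Hest : forall u v, x' <= u <= x' + t * A -> y' <= v <= y' + t * B ->
         Rabs (P u v - P x y - (px * (u - x) + k * (v - y))) <= e * s /\
         Rabs (Q u v - Q x y - (k * (u - x) + qy * (v - y))) <= e * s).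
      { intros u v Hu Hv.
        assert (Hux : Rabs (u - x) <= s) by (unfold s; apply Rabs_le_between; nra).
        assert (Hvy : Rabs (v - y) <= s) by (unfold s; apply Rabs_le_between; nra).
        assert (Hmax : Rmax (Rabs (u - x)) (Rabs (v - y)) <= s)
          by (apply Rmax_lub; assumption).
        split.
        - apply Rle_trans with (1 := H1 u v ltac:(lra) ltac:(lra)); nra.
        - apply Rle_trans with (1 := H2 u v ltac:(lra) ltac:(lra)); nra. }
      assert (BP : Rabs (RInt (fun u => P u (y' + t * B)) x' (x' + t * A)
                         - RInt (fun u => P u y') x' (x' + t * A)
                         - (x' + t * A - x') * (k * (t * B)))
                   <= (x' + t * A - x') * (2 * (e * s))).
      { apply RInt_difference_bound; try lra.
        - intros u Hu; apply (Hc u (y' + t * B)); lra.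
        - intros u Hu; apply (Hc u y'); lra.
        - intros u Hu.
          destruct (Hest u (y' + t * B) ltac:(lra) ltac:(lra)) as [E1 _].
          destruct (Hest u y' ltac:(lra) ltac:(lra)) as [E2 _].
          apply Rabs_le_between in E1, E2; apply Rabs_le_between; lra. }
      assert (BQ : Rabs (RInt (fun v => Q (x' + t * A) v) y' (y' + t * B)
                         - RInt (fun v => Q x' v) y' (y' + t * B)
                         - (y' + t * B - y') * (k * (t * A)))
                   <= (y' + t * B - y') * (2 * (e * s))).
      { apply RInt_difference_bound; try lra.
        - intros v Hv; apply (Hc (x' + t * A) v); lra.
        - intros v Hv; apply (Hc x' v); lra.
        - intros v Hv.
          destruct (Hest (x' + t * A) v ltac:(lra) ltac:(lra)) as [_ E1].
          destruct (Hest x' v ltac:(lra) ltac:(lra)) as [_ E2].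
          apply Rabs_le_between in E1, E2; apply Rabs_le_between; lra. }
      assert (Hes : t * t * eps = 4 * (s * (e * s))).
      { unfold s, e; field; nra. }
      rewrite Hes.
      assert (0 <= e * s) by (unfold s; nra).
      assert (Hs2 : s = t * A + t * B) by (unfold s; ring).
      unfold circulation.
      apply Rabs_le_between in BP, BQ; apply Rabs_le_between.
      nra. }
  apply NNPP; intros Hne.
  assert (Hp := Rabs_pos_lt _ Hne).
  specialize (Hsmall (Rabs (circulation P Q a b c d) / 2) ltac:(lra)); lra.
Qed.

(** * Continuity of complex-valued functions *)

Local Open Scope C_scope.

(* [ring] and [field] look for a ring structure on the syntactic type of the
   equation, which unification may leave as a projection of a canonical
   structure. *)
Ltac cring := match goal with |- @eq _ ?a ?b => change (@eq C a b); ring end.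
Ltac cfield := match goal with |- @eq _ ?a ?b => change (@eq C a b); field end.

(** [C] carries two uniform structures, the one of the product [R * R] and the
    one of the modulus; they have the same neighbourhoods. *)
Lemma continuous_C_iff {T : UniformSpace} (f : T -> C) (x : T) :
  continuous f x <->
  continuous (fun t => f t : AbsRing_UniformSpace C_AbsRing) x.
Proof.
  split; intros H P HP; apply H; apply locally_C; exact HP.
Qed.

Lemma continuous_Cplus {T : UniformSpace} (f g : T -> C) (x : T) :
  continuous f x -> continuous g x -> continuous (fun t => f t + g t) x.
Proof. exact (continuous_plus (V := C_NormedModule) f g x). Qed.

Lemma continuous_Cminus {T : UniformSpace} (f g : T -> C) (x : T) :
  continuous f x -> continuous g x -> continuous (fun t => f t - g t) x.
Proof. exact (continuous_minus (V := C_NormedModule) f g x). Qed.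

Lemma continuous_Cmult {T : UniformSpace} (f g : T -> C) (x : T) :
  continuous f x -> continuous g x -> continuous (fun t => f t * g t) x.
Proof.
  rewrite !continuous_C_iff.
  exact (continuous_mult (K := C_AbsRing) f g x).
Qed.

Lemma continuous_Cpair {T : UniformSpace} (f g : T -> R) (x : T) :
  continuous f x -> continuous g x -> continuous (fun t => (f t, g t) : C) x.
Proof.
  intros Hf Hg.
  apply (continuous_comp_2 (X := C_UniformSpace) f g (fun a b => (a, b)) x Hf Hg).
  apply continuous_ext with (f := fun z => z).
  - now intros [a b].
  - apply continuous_id.
Qed.

Lemma continuous_Re {T : UniformSpace} (f : T -> C) (x : T) :
  continuous f x -> continuous (fun t => Re (f t)) x.
Proof.
  intros Hf; apply (continuous_comp f fst); [exact Hf | destruct (f x); apply continuous_fst].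
Qed.

Lemma continuous_Im {T : UniformSpace} (f : T -> C) (x : T) :
  continuous f x -> continuous (fun t => Im (f t)) x.
Proof.
  intros Hf; apply (continuous_comp f snd); [exact Hf | destruct (f x); apply continuous_snd].
Qed.

Lemma continuous_Cmod {T : UniformSpace} (f : T -> C) (x : T) :
  continuous f x -> continuous (fun t => Cmod (f t)) x.
Proof.
  intros Hf.
  assert (Hr := continuous_Re f x Hf). assert (Hi := continuous_Im f x Hf).
  apply (continuous_comp (fun t => Re (f t) ^ 2 + Im (f t) ^ 2)%R sqrt);
    [| apply continuous_sqrt].
  apply continuous_ext with (f := fun t => (Re (f t) * Re (f t) + Im (f t) * Im (f t))%R).
  - intros t; simpl; f_equal; ring.
  - apply (continuous_plus (V := R_NormedModule));
      apply (continuous_mult (K := R_AbsRing)); assumption.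
Qed.

Lemma continuous_Cinv {T : UniformSpace} (f : T -> C) (x : T) :
  continuous f x -> f x <> 0 -> continuous (fun t => / f t) x.
Proof.
  intros Hf Hx.
  assert (Hr := continuous_Re f x Hf). assert (Hi := continuous_Im f x Hf).
  assert (Hn : continuous (fun t => / (Re (f t) * Re (f t) + Im (f t) * Im (f t)))%R x).
  { apply (continuous_comp
      (fun t => Re (f t) * Re (f t) + Im (f t) * Im (f t))%R Rinv).
    - apply (continuous_plus (V := R_NormedModule));
        apply (continuous_mult (K := R_AbsRing)); assumption.
    - apply continuous_Rinv; intros H0; apply Hx.
      rewrite (surjective_pairing (f x)); change (fst (f x)) with (Re (f x));
      change (snd (f x)) with (Im (f x)).
      apply injective_projections; simpl; nra. }
  apply continuous_ext with (f := fun t =>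
     (Re (f t) * / (Re (f t) * Re (f t) + Im (f t) * Im (f t)),
      (- Im (f t)) * / (Re (f t) * Re (f t) + Im (f t) * Im (f t)))%R).
  - intros t; unfold Cinv, Re, Im, Rdiv; simpl.
    rewrite !Rmult_1_r; reflexivity.
  - apply continuous_Cpair.
    + apply (continuous_mult (K := R_AbsRing)); assumption.
    + apply (continuous_mult (K := R_AbsRing)); [| assumption].
      apply (continuous_opp (V := R_NormedModule)); exact Hi.
Qed.

Lemma continuous_Cdiv {T : UniformSpace} (f g : T -> C) (x : T) :
  continuous f x -> continuous g x -> g x <> 0 ->
  continuous (fun t => f t / g t) x.
Proof.
  intros; apply continuous_Cmult; [| apply continuous_Cinv]; assumption.
Qed.

Lemma Cmod_minus_sym (a b : C) : Cmod (a - b) = Cmod (b - a).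
Proof. rewrite <- Cmod_opp; f_equal; ring. Qed.

Lemma Cmod_minus_ge (a b : C) : Cmod a - Cmod b <= Cmod (a - b).
Proof.
  assert (T := Cmod_triangle (a - b) b).
  replace (a - b + b) with a in T by ring; lra.
Qed.

Lemma sqrt_2_lt_2 : sqrt 2 < 2.
Proof. rewrite <- (sqrt_square 2) at 2 by lra; apply sqrt_lt_1; lra. Qed.

Lemma locally_Cmod (a : C) (P : C -> Prop) :
  locally a P <->
  exists d : R, 0 < d /\ forall z, Cmod (z - a) < d -> P z.
Proof.
  split.
  - intros [d Hd]; exists d; split; [apply cond_pos |].
    intros z Hz; apply Hd, C_NormedModule_mixin_compat1, Hz.
  - intros [d [Hd H]].
    assert (H2 : 0 < d / 2) by lra.
    exists (mkposreal _ H2); intros z Hz; apply H.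
    apply C_NormedModule_mixin_compat2 in Hz; simpl in Hz.
    apply Rlt_le_trans with (1 := Hz).
    assert (Hs := sqrt_2_lt_2).
    nra.
Qed.

Lemma continuous_Cmod_iff (f : C -> C) (a : C) :
  continuous f a <->
  forall eps : R, 0 < eps ->
    locally a (fun z => Cmod (f z - f a) < eps).
Proof.
  split.
  - intros Hf eps He; apply (Hf (fun y => Cmod (y - f a) < eps)); apply locally_Cmod; exists eps; auto.
  - intros Hf P HP; apply locally_Cmod in HP; destruct HP as [d [Hd H]].
    apply filter_imp with (2 := Hf d Hd); auto.
Qed.

Lemma locally_neq (a b : C) : a <> b -> locally a (fun z => z <> b).
Proof.
  intros Hab; apply locally_Cmod; exists (Cmod (a - b)); split.
  - apply Cmod_gt_0; intros H; apply Hab.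
    replace a with (a - b + b) by cring; rewrite H; cring.
  - intros z Hz ->. rewrite Cmod_minus_sym in Hz; lra.
Qed.

Lemma Cminus_neq_0 (a b : C) : a <> b -> a - b <> 0.
Proof.
  intros Hab H; apply Hab; replace a with (a - b + b) by cring; rewrite H; cring.
Qed.

(** * Complex differentiability and slopes *)

(** Caratheodory's form of differentiability: it turns the differentiation rules
    into continuity statements, and [phi] is the difference quotient whose
    boundedness is exploited later. *)
Definition C_differentiable (f : C -> C) (a : C) : Prop :=
  exists phi : C -> C, continuous phi a /\
    locally a (fun z => f z - f a = phi z * (z - a)).

Lemma C_differentiable_continuous (f : C -> C) (a : C) :
  C_differentiable f a -> continuous f a.
Proof.
  intros [phi [Hc Hl]].
  apply continuous_ext_loc with (g := fun z => f a + phi z * (z - a)).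
  - apply filter_imp with (2 := Hl); intros z Hz.
    rewrite <- Hz; cring.
  - apply continuous_Cplus; [apply continuous_const |].
    apply continuous_Cmult; [exact Hc |].
    apply continuous_Cminus; [apply continuous_id | apply continuous_const].
Qed.

Lemma C_differentiable_ext_loc (f g : C -> C) (a : C) :
  locally a (fun z => f z = g z) -> C_differentiable f a -> C_differentiable g a.
Proof.
  intros Hfg [phi [Hc Hl]]; exists phi; split; [exact Hc |].
  assert (Ha := locally_singleton _ _ Hfg); simpl in Ha.
  generalize (filter_and _ _ Hfg Hl); apply filter_imp.
  intros z [H1 H2]; rewrite <- Ha, <- H1; exact H2.
Qed.

Lemma C_differentiable_const (c a : C) : C_differentiable (fun _ => c) a.
Proof.
  exists (fun _ => 0); split; [apply continuous_const |].
  apply filter_forall; intros z; cring.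
Qed.

Lemma C_differentiable_id (a : C) : C_differentiable (fun z => z) a.
Proof.
  exists (fun _ => 1); split; [apply continuous_const |].
  apply filter_forall; intros z; cring.
Qed.

Lemma C_differentiable_plus (f g : C -> C) (a : C) :
  C_differentiable f a -> C_differentiable g a ->
  C_differentiable (fun z => f z + g z) a.
Proof.
  intros [phi [Hf Lf]] [psi [Hg Lg]].
  exists (fun z => phi z + psi z); split; [now apply continuous_Cplus |].
  generalize (filter_and _ _ Lf Lg); apply filter_imp; intros z [H1 H2].
  replace (f z + g z - (f a + g a)) with ((f z - f a) + (g z - g a)) by cring.
  rewrite H1, H2; cring.
Qed.

Lemma C_differentiable_mult (f g : C -> C) (a : C) :
  C_differentiable f a -> C_differentiable g a ->
  C_differentiable (fun z => f z * g z) a.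
Proof.
  intros Df [psi [Hg Lg]].
  assert (Cf := C_differentiable_continuous f a Df).
  destruct Df as [phi [Hf Lf]].
  exists (fun z => phi z * g a + f z * psi z); split.
  - apply continuous_Cplus; apply continuous_Cmult; try assumption.
    apply continuous_const.
  - generalize (filter_and _ _ Lf Lg); apply filter_imp; intros z [H1 H2].
    replace (f z * g z - f a * g a)
      with ((f z - f a) * g a + f z * (g z - g a)) by cring.
    rewrite H1, H2; cring.
Qed.

Lemma C_differentiable_minus (f g : C -> C) (a : C) :
  C_differentiable f a -> C_differentiable g a ->
  C_differentiable (fun z => f z - g z) a.
Proof.
  intros Df Dg.
  apply C_differentiable_ext_loc with (f := fun z => f z + (-(1)) * g z).
  - apply filter_forall; intros z; cring.
  - apply C_differentiable_plus; [exact Df |].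
    apply C_differentiable_mult; [apply C_differentiable_const | exact Dg].
Qed.

Lemma C_differentiable_inv (f : C -> C) (a : C) :
  C_differentiable f a -> f a <> 0 -> C_differentiable (fun z => / f z) a.
Proof.
  intros Df Ha.
  assert (Cf := C_differentiable_continuous f a Df).
  destruct Df as [phi [Hf Lf]].
  exists (fun z => - phi z * (/ f z * / f a)); split.
  - apply continuous_Cmult.
    + apply continuous_ext with (f := fun z => 0 - phi z); [intros; cring |].
      apply continuous_Cminus; [apply continuous_const | exact Hf].
    + apply continuous_Cmult; [now apply continuous_Cinv | apply continuous_const].
  - assert (Hn : locally a (fun z => f z <> 0)).
    { apply (Cf (fun y : C => y <> 0)); apply locally_neq; exact Ha. }
    generalize (filter_and _ _ Lf Hn); apply filter_imp; intros z [H1 H2].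
    replace (/ f z - / f a) with (- (f z - f a) * (/ f z * / f a))
      by (cfield; split; assumption).
    rewrite H1; cring.
Qed.

Lemma C_differentiable_div (f g : C -> C) (a : C) :
  C_differentiable f a -> C_differentiable g a -> g a <> 0 ->
  C_differentiable (fun z => f z / g z) a.
Proof.
  intros; apply C_differentiable_mult; [| apply C_differentiable_inv]; assumption.
Qed.

Lemma C_differentiable_comp (f g : C -> C) (a : C) :
  C_differentiable f a -> C_differentiable g (f a) ->
  C_differentiable (fun z => g (f z)) a.
Proof.
  intros Df [psi [Hg Lg]].
  assert (Cf := C_differentiable_continuous f a Df).
  destruct Df as [phi [Hf Lf]].
  exists (fun z => psi (f z) * phi z); split.
  - apply continuous_Cmult; [| exact Hf].
    now apply (continuous_comp f psi).
  - apply Cf in Lg. generalize (filter_and _ _ Lf Lg); apply filter_imp.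
    intros z [H1 H2]. rewrite H2, H1; cring.
Qed.

(** The value [l] at the base point is left free; [slope_continuous_base] provides
    the one that makes the function continuous there. *)
Definition slope (f : C -> C) (a l z : C) : C :=
  if excluded_middle_informative (z = a) then l else (f z - f a) / (z - a).

Lemma slope_mult (f : C -> C) (a l z : C) : slope f a l z * (z - a) = f z - f a.
Proof.
  unfold slope; destruct excluded_middle_informative as [-> | H].
  - cring.
  - cfield; now apply Cminus_neq_0.
Qed.

Lemma slope_neq (f : C -> C) (a l z : C) :
  z <> a -> slope f a l z = (f z - f a) / (z - a).
Proof.
  intros H; unfold slope; destruct excluded_middle_informative; congruence.
Qed.

Lemma slope_continuous_base (f : C -> C) (a : C) :
  C_differentiable f a -> exists l, continuous (slope f a l) a.
Proof.
  intros [phi [Hc Hl]]; exists (phi a).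
  apply continuous_ext_loc with (g := phi); [| exact Hc].
  apply filter_imp with (2 := Hl); intros z Hz.
  unfold slope; destruct excluded_middle_informative as [-> | H]; [reflexivity |].
  rewrite Hz; cfield; now apply Cminus_neq_0.
Qed.

Lemma slope_continuous (f : C -> C) (a l z : C) :
  z <> a -> continuous f z -> continuous (slope f a l) z.
Proof.
  intros Hz Hf.
  apply continuous_ext_loc with (g := fun z => (f z - f a) / (z - a)).
  - apply filter_imp with (2 := locally_neq z a Hz); intros y Hy.
    now rewrite slope_neq.
  - apply continuous_Cdiv; [| | now apply Cminus_neq_0];
      apply continuous_Cminus; try apply continuous_const;
      [exact Hf | apply continuous_id].
Qed.

Lemma slope_differentiable (f : C -> C) (a l z : C) :
  z <> a -> C_differentiable f z -> C_differentiable (slope f a l) z.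
Proof.
  intros Hz Hf.
  apply C_differentiable_ext_loc with (f := fun z => (f z - f a) / (z - a)).
  - apply filter_imp with (2 := locally_neq z a Hz); intros y Hy.
    now rewrite slope_neq.
  - apply C_differentiable_div; [| | now apply Cminus_neq_0];
      apply C_differentiable_minus; try apply C_differentiable_const;
      [exact Hf | apply C_differentiable_id].
Qed.

(** * The mean value property *)

Lemma cauchy_riemann (f : C -> C) (x y : R) :
  C_differentiable f (x, y) -> exists p q : R,
    differentiable_pt_lim (fun u v => Re (f (u, v))) x y p (- q) /\
    differentiable_pt_lim (fun u v => Im (f (u, v))) x y q p.
Proof.
  intros [phi [Hc Hl]].
  exists (Re (phi (x, y))), (Im (phi (x, y))).
  assert (Hest : forall eps : posreal, locally_2d (fun u v =>
     Cmod (f (u, v) - f (x, y) - phi (x, y) * ((u, v) - (x, y))) <=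
     eps * Rmax (Rabs (u - x)) (Rabs (v - y))) x y).
  { intros eps.
    assert (He : 0 < eps / 2) by (generalize (cond_pos eps); lra).
    assert (Hc' := proj1 (continuous_Cmod_iff _ _) Hc _ He).
    assert (H := filter_and _ _ Hc' Hl); clear Hc' Hl.
    destruct H as [d Hd]; exists d; intros u v Hu Hv.
    destruct (Hd (u, v) (conj Hu Hv)) as [H1 H2].
    rewrite H2.
    replace (phi (u, v) * ((u, v) - (x, y)) - phi (x, y) * ((u, v) - (x, y)))
      with ((phi (u, v) - phi (x, y)) * ((u, v) - (x, y))) by cring.
    rewrite Cmod_mult.
    assert (H3 := Cmod_2Rmax ((u, v) - (x, y))). cbn [fst snd Cminus Cplus Copp] in H3.
    change (u + - x)%R with (u - x)%R in H3; change (v + - y)%R with (v - y)%R in H3.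
    set (m := Rmax _ _) in *.
    assert (Hs := sqrt_2_lt_2).
    assert (0 <= m)%R by (apply Rle_trans with (2 := Rmax_l _ _); apply Rabs_pos).
    assert (Cmod ((u, v) - (x, y)) <= 2 * m)%R by nra.
    assert (H5 := Cmod_ge_0 ((u, v) - (x, y))).
    assert (H6 := Cmod_ge_0 (phi (u, v) - phi (x, y))).
    apply Rle_trans with (eps / 2 * (2 * m))%R; [| lra].
    apply Rmult_le_compat; lra. }
  split; intros eps; destruct (Hest eps) as [d Hd]; exists d; intros u v Hu Hv;
    apply Rle_trans with (2 := Hd u v Hu Hv).
  - apply Rle_trans with (2 := re_le_Cmod _).
    apply Req_le; f_equal; unfold Re, Im, Cminus, Cplus, Copp, Cmult; cbn [fst snd]; ring.
  - apply Rle_trans with (2 := Rle_trans _ _ _ (Rmax_r _ _) (Rmax_Cmod _)).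
    apply Req_le; f_equal; unfold Re, Im, Cminus, Cplus, Copp, Cmult; cbn [fst snd]; ring.
Qed.

Lemma differentiable_pt_lim_mult (f g : R -> R -> R) (x y fx fy gx gy : R) :
  differentiable_pt_lim f x y fx fy -> differentiable_pt_lim g x y gx gy ->
  differentiable_pt_lim (fun u v => f u v * g u v)%R x y
    (fx * g x y + f x y * gx) (fy * g x y + f x y * gy).
Proof.
  intros Hf Hg.
  replace (fx * g x y + f x y * gx)%R with (g x y * fx + f x y * gx)%R by ring.
  replace (fy * g x y + f x y * gy)%R with (g x y * fy + f x y * gy)%R by ring.
  apply (differentiable_pt_lim_comp (fun a b => a * b)%R f g); try assumption.
  intros eps; exists eps; intros u v Hu Hv.
  replace (u * v - f x y * g x y - (g x y * (u - f x y) + f x y * (v - g x y)))%R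
    with ((u - f x y) * (v - g x y))%R by ring.
  rewrite Rabs_mult.
  assert (H1 := Rmax_r (Rabs (u - f x y)) (Rabs (v - g x y))).
  assert (H2 := Rabs_pos (v - g x y)). assert (H3 := Rabs_pos (u - f x y)).
  apply Rmult_le_compat; lra.
Qed.

Lemma differentiable_pt_lim_plus (f g : R -> R -> R) (x y fx fy gx gy : R) :
  differentiable_pt_lim f x y fx fy -> differentiable_pt_lim g x y gx gy ->
  differentiable_pt_lim (fun u v => f u v + g u v)%R x y (fx + gx) (fy + gy).
Proof.
  intros Hf Hg eps.
  assert (He : 0 < eps / 2) by (generalize (cond_pos eps); lra).
  destruct (Hf (mkposreal _ He)) as [d1 H1].
  destruct (Hg (mkposreal _ He)) as [d2 H2]; simpl in H1, H2.
  exists (mkposreal _ (Rmin_pos _ _ (cond_pos d1) (cond_pos d2))); simpl.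
  intros u v Hu Hv.
  assert (Hm1 := Rmin_l d1 d2). assert (Hm2 := Rmin_r d1 d2).
  specialize (H1 u v ltac:(lra) ltac:(lra)).
  specialize (H2 u v ltac:(lra) ltac:(lra)).
  apply Rabs_le_between in H1, H2; apply Rabs_le_between; lra.
Qed.

Lemma differentiable_pt_lim_const (c x y : R) :
  differentiable_pt_lim (fun _ _ => c) x y 0 0.
Proof.
  apply (differentiable_pt_lim_proj1_0 (fun _ => c)), derivable_pt_lim_const.
Qed.

Lemma differentiable_pt_lim_proj2_0 (f : R -> R) (x y l : R) :
  derivable_pt_lim f y l -> differentiable_pt_lim (fun _ v => f v) x y 0 l.
Proof.
  intros H eps.
  destruct (differentiable_pt_lim_proj1_0 f y x l H eps) as [d Hd].
  exists d; intros u v Hu Hv.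
  specialize (Hd v u Hv Hu). rewrite Rmax_comm.
  replace (0 * (u - x) + l * (v - y))%R with (l * (v - y) + 0 * (u - x))%R by ring.
  exact Hd.
Qed.

(** The point [z0 + r e^(it)]. *)
Definition circle_point (z0 : C) (r t : R) : C :=
  (Re z0 + r * cos t, Im z0 + r * sin t)%R.

Lemma Cmod_circle_point (z0 : C) (r t : R) :
  0 <= r -> Cmod (circle_point z0 r t - z0) = r.
Proof.
  intros Hr; unfold Cmod, circle_point, Re, Im; simpl.
  rewrite <- (sqrt_square r) at 5 by exact Hr.
  f_equal; generalize (sin2_cos2 t); unfold Rsqr; intros H; nra.
Qed.

Lemma continuous_circle_point (z0 : C) (r t : R) :
  continuous (fun t => circle_point z0 r t) t.
Proof.
  apply continuous_Cpair;
    apply (continuous_plus (V := R_NormedModule)); try apply continuous_const;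
    apply (continuous_scal_r (V := R_NormedModule));
    [apply continuous_cos | apply continuous_sin].
Qed.

Lemma ex_RInt_circle (z0 : C) (r a b : R) (f : C -> R) :
  (forall t, continuous f (circle_point z0 r t)) ->
  ex_RInt (fun t => f (circle_point z0 r t)) a b.
Proof.
  intros H; apply (ex_RInt_continuous (V := R_CompleteNormedModule)); intros t _.
  apply (continuous_comp (fun t => circle_point z0 r t) f);
    [apply continuous_circle_point | apply H].
Qed.

(** The form is the imaginary part of [f dz / (z - z0)].  Its closedness is the
    Cauchy-Riemann equation [du/dr = (1/r) dv/dt]. *)
Lemma polar_closed_form (f : C -> C) (z0 : C) (r t : R) :
  0 < r -> C_differentiable f (circle_point z0 r t) -> exists a k b,
    differentiable_pt_lim (fun r t => Im (f (circle_point z0 r t)) * / r)%R r t a k /\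
    differentiable_pt_lim (fun r t => Re (f (circle_point z0 r t))) r t k b.
Proof.
  intros Hr Hf.
  destruct (cauchy_riemann f _ _ Hf) as [p [q [Hu Hv]]].
  assert (Hid : differentiable_pt_lim (fun r _ => r) r t 1 0)
    by (apply (differentiable_pt_lim_proj1_0 (fun r => r)), derivable_pt_lim_id).
  assert (Hx : differentiable_pt_lim (fun r t => Re z0 + r * cos t)%R r t
     (0 + (1 * cos t + r * 0)) (0 + (0 * cos t + r * (- sin t)))).
  { apply differentiable_pt_lim_plus; [apply differentiable_pt_lim_const |].
    apply (differentiable_pt_lim_mult (fun r _ => r) (fun _ t => cos t)); [exact Hid |].
    apply differentiable_pt_lim_proj2_0, derivable_pt_lim_cos. }
  assert (Hy : differentiable_pt_lim (fun r t => Im z0 + r * sin t)%R r t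
     (0 + (1 * sin t + r * 0)) (0 + (0 * sin t + r * cos t))).
  { apply differentiable_pt_lim_plus; [apply differentiable_pt_lim_const |].
    apply (differentiable_pt_lim_mult (fun r _ => r) (fun _ t => sin t)); [exact Hid |].
    apply differentiable_pt_lim_proj2_0, derivable_pt_lim_sin. }
  assert (Hinv : differentiable_pt_lim (fun r _ => / r)%R r t (- / r ^ 2) 0).
  { apply (differentiable_pt_lim_proj1_0 Rinv).
    apply is_derive_Reals. auto_derive; [lra | field; lra]. }
  assert (HU := differentiable_pt_lim_comp _ _ _ _ _ _ _ _ _ _ _ Hu Hx Hy).
  assert (HV := differentiable_pt_lim_comp _ _ _ _ _ _ _ _ _ _ _ Hv Hx Hy).
  assert (HVr := differentiable_pt_lim_mult _ _ _ _ _ _ _ _ HV Hinv).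
  match type of HU with differentiable_pt_lim _ _ _ ?k ?b =>
  match type of HVr with differentiable_pt_lim _ _ _ ?a ?k' =>
    exists a, k, b; split; [| exact HU];
    replace k with k'; [exact HVr |] end end.
  field; lra.
Qed.

(** The circle mean is independent of the radius, since the form of
    [polar_closed_form] is closed and periodic in the angle; as the radius tends
    to 0 it tends to the value at the centre, by continuity.  Nothing is asked of
    the derivative at [z0], which lets exceptional points through. *)
Theorem mean_value_property (f : C -> C) (z0 : C) (rho r : R) :
  continuous f z0 ->
  (forall z, z <> z0 -> Cmod (z - z0) < rho -> C_differentiable f z) ->
  0 < r < rho ->
  RInt (fun t => Re (f (circle_point z0 r t))) 0 (2 * PI) = (2 * PI * Re (f z0))%R.
Proof.
  intros Hc HD Hr.
  assert (Hpi := PI_RGT_0).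
  assert (HD' : forall s t, 0 < s < rho -> C_differentiable f (circle_point z0 s t)).
  { intros s t Hs; assert (E := Cmod_circle_point z0 s t ltac:(lra)).
    apply HD; [| rewrite E; lra]. intros H; rewrite H in E.
    unfold Cminus in E; rewrite Cplus_opp_r, Cmod_0 in E; lra. }
  assert (HI : forall s, 0 < s < rho ->
    ex_RInt (fun t => Re (f (circle_point z0 s t))) 0 (2 * PI)).
  { intros s Hs; apply (ex_RInt_circle _ _ _ _ (fun z => Re (f z))).
    intros t; apply continuous_Re, C_differentiable_continuous, HD', Hs. }
  assert (Hconst : forall s, 0 < s < r ->
     RInt (fun t => Re (f (circle_point z0 r t))) 0 (2 * PI) =
     RInt (fun t => Re (f (circle_point z0 s t))) 0 (2 * PI)).
  { intros s Hs.
    assert (G := closed_form_circulation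
      (fun r t => Im (f (circle_point z0 r t)) * / r)%R
      (fun r t => Re (f (circle_point z0 r t))) s r 0 (2 * PI)
      ltac:(lra) ltac:(lra)
      ltac:(intros x y Hx _; apply polar_closed_form; [lra | apply HD'; lra])).
    unfold circulation in G.
    rewrite (RInt_ext (fun x => Im (f (circle_point z0 x (2 * PI))) * / x)%R
      (fun x => Im (f (circle_point z0 x 0)) * / x)%R) in G; [lra |].
    intros x _; unfold circle_point; rewrite cos_2PI, sin_2PI, cos_0, sin_0; reflexivity. }
  apply NNPP; intros Hne; apply Rminus_eq_contra in Hne.
  set (J := RInt (fun t => Re (f (circle_point z0 r t))) 0 (2 * PI)) in *.
  set (e := (Rabs (J - 2 * PI * Re (f z0)) / (4 * PI))%R).
  assert (He : 0 < e)
    by (apply Rdiv_lt_0_compat; [apply Rabs_pos_lt; exact Hne | lra]).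
  assert (Hl := proj1 (continuous_Cmod_iff f z0) Hc e He).
  apply locally_Cmod in Hl; destruct Hl as [d [Hd Hl]].
  set (s := (Rmin d r / 2)%R).
  assert (Hs : 0 < Rmin d r) by (apply Rmin_pos; lra).
  assert (H1 := Rmin_l d r); assert (H2 := Rmin_r d r).
  assert (Hs' : 0 < s < r) by (unfold s; lra).
  assert (B : Rabs (J - 2 * PI * Re (f z0)) <= 2 * PI * e).
  { rewrite (Hconst s Hs').
    assert (B := RInt_difference_bound (fun t => Re (f (circle_point z0 s t)))
       (fun _ => 0) 0 (2 * PI) (Re (f z0)) e ltac:(lra)).
    rewrite RInt_const in B. unfold scal in B; simpl in B; unfold mult in B; simpl in B.
    replace ((2 * PI - 0) * e)%R with (2 * PI * e)%R in B by ring.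
    replace ((2 * PI - 0) * Re (f z0))%R with (2 * PI * Re (f z0))%R in B by ring.
    rewrite Rmult_0_r, Rminus_0_r in B. apply B; clear B.
    - intros t _; apply (continuous_comp (fun t => circle_point z0 s t) (fun z => Re (f z)));
        [apply continuous_circle_point |].
      apply continuous_Re, C_differentiable_continuous, HD'; lra.
    - intros t _; apply continuous_const.
    - intros t _; rewrite Rminus_0_r.
      replace (Re (f (circle_point z0 s t)) - Re (f z0))%R
        with (Re (f (circle_point z0 s t) - f z0)) by reflexivity.
      apply Rle_trans with (1 := re_le_Cmod _), Rlt_le, Hl.
      rewrite Cmod_circle_point by lra. unfold s; lra. }
  assert (E : (2 * PI * e = Rabs (J - 2 * PI * Re (f z0)) / 2)%R) by (unfold e; field; lra).
  apply Rabs_pos_lt in Hne; lra.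
Qed.

(** * Compactness of closed discs *)

(** A property of sets that is inherited by subsets and finite unions, and that
    holds near each point, holds for the closed disc.  This serves both for the
    boundedness of continuous functions and for the existence of maxima. *)
Lemma closed_disc_compactness_induction (rad : R) (P : (C -> Prop) -> Prop) :
  0 <= rad ->
  (forall S T : C -> Prop, (forall z, S z -> T z) -> P T -> P S) ->
  (forall S T : C -> Prop, P S -> P T -> P (fun z => S z \/ T z)) ->
  (forall a, Cmod a <= rad -> exists N : C -> Prop,
     locally a N /\ P (fun z => N z /\ Cmod z <= rad)) ->
  P (fun z => Cmod z <= rad).
Proof.
  intros HR Hmono Hunion Hloc.
  set (box := fun (x y t : R) (z : C) => (x <= Re z <= x + t * (2 * rad))%R /\
     (y <= Im z <= y + t * (2 * rad))%R /\ Cmod z <= rad).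
  cut (P (box (- rad) (- rad) 1)%R).
  { apply Hmono; intros z Hz.
    assert (H := Rle_trans _ _ _ (Rmax_l _ _) (Rmax_Cmod z)).
    assert (H' := Rle_trans _ _ _ (Rmax_r _ _) (Rmax_Cmod z)).
    assert (A1 : Rabs (Re z) <= rad) by (unfold Re; lra).
    assert (A2 : Rabs (Im z) <= rad) by (unfold Im; lra).
    apply Rabs_le_between in A1, A2. unfold box; lra. }
  apply (rectangle_subdivision (2 * rad) (2 * rad) (fun x y t => P (box x y t))); try lra.
  - intros x y t Ht H1 H2 H3 H4.
    apply Hmono with (2 := Hunion _ _ (Hunion _ _ H1 H2) (Hunion _ _ H3 H4)).
    unfold box; intros z [Hx [Hy Hz]].
    assert (E : (t * (2 * rad) = t / 2 * (2 * rad) + t / 2 * (2 * rad))%R) by field.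
    set (w := (t / 2 * (2 * rad))%R) in *.
    destruct (Rle_dec (Re z) (x + w)); destruct (Rle_dec (Im z) (y + w)); lra.
  - intros x y.
    assert (Hnear : forall e, 0 < e -> exists d, 0 < d /\ forall x' y' t, 0 < t < d ->
      (x' <= x <= x' + t * (2 * rad))%R -> (y' <= y <= y' + t * (2 * rad))%R ->
      forall z, box x' y' t z -> Cmod (z - (x, y)) < e).
    { intros e He; exists (e / (4 * rad + 1))%R.
      split; [apply Rdiv_lt_0_compat; lra |].
      intros x' y' t [Ht Ht'] Hx Hy z [Hzx [Hzy _]].
      apply Rmult_lt_compat_r with (r := (4 * rad + 1)%R) in Ht'; [| lra].
      unfold Rdiv in Ht'; rewrite Rmult_assoc, Rinv_l, Rmult_1_r in Ht' by lra.
      apply Rle_lt_trans with (1 := Cmod_2Rmax _).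
      set (m := Rmax _ _).
      assert (Hm : m <= t * (2 * rad)).
      { unfold m, Re, Im, Cminus, Cplus, Copp in *; cbn [fst snd].
        apply Rmax_lub; apply Rabs_le_between; lra. }
      assert (Hs := sqrt_2_lt_2).
      assert (0 <= m)%R by (apply Rle_trans with (2 := Rmax_l _ _); apply Rabs_pos).
      assert (sqrt 2 * m <= 2 * m)%R by nra. lra. }
    destruct (Rle_lt_dec (Cmod (x, y)) rad) as [Hin | Hout].
    + destruct (Hloc _ Hin) as [N [HN HP]].
      apply locally_Cmod in HN; destruct HN as [e [He HN]].
      destruct (Hnear e He) as [d [Hd H]]; exists d; split; [exact Hd |].
      intros x' y' t Ht Hx Hy; apply Hmono with (2 := HP).
      intros z Hz; split; [apply HN, (H x' y' t); assumption | apply Hz].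
    + destruct (Hnear (Cmod (x, y) - rad)%R ltac:(lra)) as [d [Hd H]].
      exists d; split; [exact Hd |].
      intros x' y' t Ht Hx Hy.
      destruct (Hloc 0) as [N [_ HP]]; [rewrite Cmod_0; exact HR |].
      apply Hmono with (2 := HP); intros z Hz; exfalso.
      specialize (H x' y' t Ht Hx Hy z Hz).
      assert (T := Cmod_minus_ge (x, y) z).
      rewrite Cmod_minus_sym in H.
      destruct Hz as [_ [_ Hz]]; lra.
Qed.

Lemma continuous_bounded_above (w : C -> R) (rad : R) :
  0 <= rad -> (forall z, Cmod z <= rad -> continuous w z) ->
  exists M, forall z, Cmod z <= rad -> w z <= M.
Proof.
  intros HR Hw.
  apply (closed_disc_compactness_induction rad
    (fun S => exists M, forall z, S z -> w z <= M) HR).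
  - intros S T HST [M HM]; exists M; auto.
  - intros S T [M HM] [N HN]; exists (Rmax M N); intros z [Hz | Hz].
    + apply Rle_trans with (2 := Rmax_l _ _); auto.
    + apply Rle_trans with (2 := Rmax_r _ _); auto.
  - intros a Ha; exists (fun z => w z < w a + 1)%R; split.
    + apply (Hw a Ha (fun y => y < w a + 1)%R), open_lt; lra.
    + exists (w a + 1)%R; intros z [Hz _]; lra.
Qed.

Lemma continuous_maximum (w : C -> R) (rad : R) :
  0 <= rad -> (forall z, Cmod z <= rad -> continuous w z) ->
  exists a, Cmod a <= rad /\ forall z, Cmod z <= rad -> w z <= w a.
Proof.
  intros HR Hw.
  destruct (continuous_bounded_above w rad HR Hw) as [B HB].
  destruct (completeness (fun y => exists z, Cmod z <= rad /\ y = w z)) as [s [Hs1 Hs2]].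
  { exists B; intros y [z [Hz ->]]; auto. }
  { exists (w 0), 0; split; [rewrite Cmod_0; exact HR | reflexivity]. }
  apply NNPP; intros Hno.
  assert (Hlt : forall a, Cmod a <= rad -> w a < s).
  { intros a Ha; apply Rnot_le_lt; intros Hle; apply Hno; exists a; split; [exact Ha |].
    intros z Hz; apply Rle_trans with (2 := Hle); apply Hs1; exists z; auto. }
  assert (H : exists M, M < s /\ forall z, Cmod z <= rad -> w z <= M).
  { apply (closed_disc_compactness_induction rad
      (fun S => exists M, M < s /\ forall z, S z -> w z <= M) HR).
    - intros S T HST [M [HM1 HM]]; exists M; auto.
    - intros S T [M [HM1 HM]] [N [HN1 HN]]; exists (Rmax M N).
      split; [apply Rmax_lub_lt; assumption |]. intros z [Hz | Hz].
      + apply Rle_trans with (2 := Rmax_l _ _); auto.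
      + apply Rle_trans with (2 := Rmax_r _ _); auto.
    - intros a Ha; specialize (Hlt a Ha).
      exists (fun z => w z < (w a + s) / 2)%R; split.
      + apply (Hw a Ha (fun y => y < (w a + s) / 2)%R), open_lt; lra.
      + exists ((w a + s) / 2)%R; split; [lra |]; intros z [Hz _]; lra. }
  destruct H as [M [HM1 HM]].
  apply Rlt_not_le with (1 := HM1), Hs2.
  intros y [z [Hz ->]]; auto.
Qed.

Lemma locally_avoids_list (S : list C) (a : C) :
  locally a (fun z => z <> a -> ~ In z S).
Proof.
  induction S as [| b S IH]; [apply filter_forall; simpl; tauto |].
  destruct (classic (a = b)) as [<- | Hab].
  - apply filter_imp with (2 := IH); intros z H Hz [<- | Hin]; tauto.
  - generalize (filter_and _ _ IH (locally_neq a b Hab)); apply filter_imp.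
    intros z [H1 H2] Hz [<- | Hin]; tauto.
Qed.

(** * Maximum modulus principle and Liouville's theorem *)

(** At an interior maximum of [Re f + e |z|^2] the mean value property is
    contradicted, because the mean of [|z|^2] over a circle of radius [r] exceeds
    its value at the centre by [r^2].  The term [e |z|^2] replaces any discussion
    of equality; then [e] tends to 0. *)
Lemma real_part_maximum_principle (f : C -> C) (S : list C) (rad M : R) :
  0 < rad ->
  (forall z, Cmod z <= rad -> continuous f z) ->
  (forall z, Cmod z < rad -> ~ In z S -> C_differentiable f z) ->
  (forall z, Cmod z = rad -> Re (f z) <= M) ->
  forall z, Cmod z <= rad -> Re (f z) <= M.
Proof.
  intros HR Hc HD HM z Hz.
  apply le_epsilon; intros eps Heps.
  set (e := (eps / (rad * rad))%R).
  assert (He : 0 < e) by (apply Rdiv_lt_0_compat; nra).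
  assert (Ee : (e * (rad * rad) = eps)%R) by (unfold e; field; lra).
  (* The perturbation adds at most [eps] on the disc. *)
  set (w := fun z => (Re (f z) + e * (Cmod z * Cmod z))%R).
  destruct (continuous_maximum w rad) as [a [Ha Hmax]]; [lra | |].
  { intros y Hy; apply (continuous_plus (V := R_NormedModule)).
    - now apply continuous_Re, Hc.
    - apply (continuous_scal_r (V := R_NormedModule)).
      apply (continuous_mult (K := R_AbsRing));
        apply (continuous_Cmod (fun z => z)), continuous_id. }
  assert (Hw := Hmax z Hz); unfold w in Hw.
  assert (Hz0 := Cmod_ge_0 z).
  assert (0 <= e * (Cmod z * Cmod z))%R by nra.
  destruct Ha as [Ha | Ha].
  2: { specialize (HM a Ha); rewrite Ha in Hw; lra. }
  exfalso.
  assert (HS := locally_avoids_list S a); apply locally_Cmod in HS.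
  destruct HS as [d [Hd HS]].
  set (rho := Rmin d (rad - Cmod a)).
  assert (Hrho : 0 < rho) by (apply Rmin_pos; lra).
  assert (Hr1 := Rmin_l d (rad - Cmod a)); assert (Hr2 := Rmin_r d (rad - Cmod a)).
  fold rho in Hr1, Hr2.
  assert (Hball : forall y, Cmod (y - a) < rho -> Cmod y < rad).
  { intros y Hy; assert (T := Cmod_minus_ge y a); lra. }
  set (r := (rho / 2)%R).
  assert (Hr : 0 < r < rho) by (unfold r; lra).
  assert (Hmean := mean_value_property f a rho r (Hc a (Rlt_le _ _ Ha))
    ltac:(intros y Hy1 Hy2; apply HD; [auto | apply HS; [lra | auto]]) Hr).
  assert (Hpi := PI_RGT_0).
  set (k := fun t => (e * (r * r + 2 * r * (Re a * cos t + Im a * sin t)))%R).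
  set (K := fun t => (e * (r * r * t + 2 * r * (Re a * sin t - Im a * cos t)))%R).
  (* [k] is [e] times the increase of [|z|^2] from [a] to the point of the circle
     at angle [t]; [K] is a primitive of it. *)
  assert (HkI : is_RInt k 0 (2 * PI) (2 * PI * (e * (r * r)))%R).
  { replace (2 * PI * (e * (r * r)))%R with (minus (K (2 * PI)%R) (K 0)).
    - apply (is_RInt_derive (V := R_CompleteNormedModule)).
      + intros t _; unfold K, k. auto_derive; [exact I | ring].
      + intros t _; unfold k. apply (ex_derive_continuous (K := R_AbsRing) (V := R_NormedModule)).
        auto_derive; exact I.
    - unfold K; rewrite cos_2PI, sin_2PI, cos_0, sin_0.
      unfold minus, plus, opp; simpl; ring. }
  assert (Hle : RInt (fun t => Re (f (circle_point a r t))) 0 (2 * PI) <=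
                RInt (fun t => Re (f a) - k t)%R 0 (2 * PI)).
  { apply RInt_le; [lra | | |].
    - apply (ex_RInt_circle _ _ _ _ (fun z => Re (f z))); intros t.
      apply continuous_Re, Hc, Rlt_le, Hball; rewrite Cmod_circle_point; lra.
    - apply (ex_RInt_minus (V := R_NormedModule)); [apply ex_RInt_const |].
      eexists; exact HkI.
    - intros t _.
      assert (Ht := Hmax (circle_point a r t)
         ltac:(apply Rlt_le, Hball; rewrite Cmod_circle_point; lra)).
      unfold w in Ht.
      assert (E1 := Cmod2_alt (circle_point a r t)); assert (E2 := Cmod2_alt a).
      assert (E3 : (Re (circle_point a r t) ^ 2 + Im (circle_point a r t) ^ 2 =
        Re a ^ 2 + Im a ^ 2 + (r * r + 2 * r * (Re a * cos t + Im a * sin t)))%R).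
      { unfold circle_point; simpl. generalize (sin2_cos2 t); unfold Rsqr; intros E3. nra. }
      rewrite E3, <- E2 in E1. unfold k.
      replace (Cmod (circle_point a r t) * Cmod (circle_point a r t))%R
        with (Cmod (circle_point a r t) ^ 2)%R in Ht by ring.
      rewrite E1 in Ht; lra. }
  rewrite (RInt_minus (V := R_CompleteNormedModule) (fun _ => Re (f a)) k) in Hle;
    [| apply ex_RInt_const | eexists; exact HkI].
  rewrite (is_RInt_unique _ _ _ _ HkI), RInt_const, Hmean in Hle.
  unfold minus, plus, opp, scal in Hle; simpl in Hle; unfold mult in Hle; simpl in Hle.
  assert (0 < 2 * PI * (e * (r * r)))%R.
  { apply Rmult_lt_0_compat; [lra | apply Rmult_lt_0_compat; nra]. }
  lra.
Qed.

(** Rotating [f] so that [f z] becomes real and nonnegative reduces the modulus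
    to the real part. *)
Theorem maximum_modulus_principle (f : C -> C) (S : list C) (rad M : R) :
  0 < rad ->
  (forall z, Cmod z <= rad -> continuous f z) ->
  (forall z, Cmod z < rad -> ~ In z S -> C_differentiable f z) ->
  (forall z, Cmod z = rad -> Cmod (f z) <= M) ->
  forall z, Cmod z <= rad -> Cmod (f z) <= M.
Proof.
  intros HR Hc HD HM z Hz.
  assert (HM0 : 0 <= M).
  { apply Rle_trans with (1 := Cmod_ge_0 (f (RtoC rad))), HM.
    rewrite Cmod_R; apply Rabs_pos_eq; lra. }
  destruct (Req_dec (Cmod (f z)) 0) as [H0 | H0]; [lra |].
  set (c := Cconj (f z) / RtoC (Cmod (f z))).
  assert (Hcne : RtoC (Cmod (f z)) <> 0).
  { intros E; apply RtoC_inj in E; contradiction. }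
  assert (Hc1 : Cmod c = 1%R).
  { unfold c; rewrite Cmod_div, Cmod_conj, Cmod_R, Rabs_pos_eq by
      (try assumption; apply Cmod_ge_0); field; exact H0. }
  replace (Cmod (f z)) with (Re (c * f z)).
  - apply (real_part_maximum_principle (fun z => c * f z) S rad M HR); try assumption.
    + intros y Hy; apply continuous_Cmult; [apply continuous_const | auto].
    + intros y Hy HyS; apply C_differentiable_mult; [apply C_differentiable_const | auto].
    + intros y Hy; apply Rle_trans with (1 := Rle_abs _), Rle_trans with (1 := re_le_Cmod _).
      rewrite Cmod_mult, Hc1, Rmult_1_l; auto.
  - replace (c * f z) with (RtoC (Cmod (f z))); [apply re_RtoC |].
    unfold c. assert (E := Cmod2_conj (f z)).
    replace (Cconj (f z) / RtoC (Cmod (f z)) * f z)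
      with ((f z * Cconj (f z)) / RtoC (Cmod (f z))) by (field; assumption).
    rewrite <- E. rewrite RtoC_pow. field; assumption.
Qed.

Lemma fresh_point (S : list C) : exists q, ~ In q S.
Proof.
  apply NNPP; intros H.
  assert (Hall : forall n, In (INR n : C) S).
  { intros n; apply NNPP; intros Hn; apply H; eexists; exact Hn. }
  assert (Hbound : exists M, forall z, In z S -> Cmod z <= M).
  { clear; induction S as [| a S [M HM]]; [exists 0%R; simpl; tauto |].
    exists (Rmax (Cmod a) M); intros z [<- | Hz]; [apply Rmax_l |].
    apply Rle_trans with (2 := Rmax_r _ _); auto. }
  destruct Hbound as [M HM]. destruct (INR_unbounded M) as [n Hn].
  specialize (HM _ (Hall n)). rewrite Cmod_R, Rabs_pos_eq in HM by apply pos_INR; lra.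
Qed.

(** The slope of [f] at a point [q] outside [S] is bounded on large circles by an
    arbitrarily small constant, hence vanishes by the maximum principle, in which
    [q] joins the exceptional points. *)
Theorem liouville_sublinear (f : C -> C) (S : list C) :
  (forall z, continuous f z) ->
  (forall z, ~ In z S -> C_differentiable f z) ->
  (forall eps, 0 < eps -> exists R0, forall z, R0 <= Cmod z -> Cmod (f z) <= eps * Cmod z) ->
  forall z w, f z = f w.
Proof.
  intros Hc HD Hg.
  destruct (fresh_point S) as [q Hq].
  cut (forall z, f z = f q); [intros H z w; now rewrite !H |].
  intros z.
  destruct (slope_continuous_base f q (HD q Hq)) as [l Hl].
  assert (Hsc : forall y, continuous (slope f q l) y).
  { intros y; destruct (classic (y = q)) as [-> | Hy]; [exact Hl |].
    now apply slope_continuous. }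
  assert (H0 : Cmod (slope f q l z) <= 0).
  { apply le_epsilon; intros eps He; rewrite Rplus_0_l.
    destruct (Hg (eps / 4)%R ltac:(lra)) as [R0 HR0].
    assert (HF := Cmod_ge_0 (f q)). assert (HQ := Cmod_ge_0 q). assert (HZ := Cmod_ge_0 z).
    assert (HFe : 0 <= Cmod (f q) / eps * 4) by
      (apply Rmult_le_pos; [apply Rle_div_r; lra | lra]).
    (* On the circle of this radius both [f y] and [f q] have modulus at most
       [eps / 4] times the radius, and [y - q] has modulus at least half of it. *)
    set (rad := (Rmax R0 0 + Cmod z + 2 * Cmod q + Cmod (f q) / eps * 4 + 1)%R).
    assert (HR1 := Rmax_l R0 0). assert (HR2 := Rmax_r R0 0).
    apply (maximum_modulus_principle (slope f q l) (q :: S) rad); try (unfold rad; lra).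
    - intros y _; apply Hsc.
    - intros y _ Hy; simpl in Hy; apply slope_differentiable; [| apply HD]; intuition congruence.
    - intros y Hy.
      assert (Hyq : rad - Cmod q <= Cmod (y - q)).
      { assert (T := Cmod_minus_ge y q); lra. }
      assert (HRq : rad / 2 <= rad - Cmod q) by (unfold rad; lra).
      assert (Hpos : 0 < rad) by (unfold rad; lra).
      assert (Hm : Cmod (slope f q l y) * Cmod (y - q) <= eps / 4 * rad + Cmod (f q)).
      { rewrite <- Cmod_mult, slope_mult.
        assert (T := Cmod_triangle (f y) (- f q)). rewrite Cmod_opp in T.
        assert (Hy' := HR0 y ltac:(rewrite Hy; unfold rad; lra)). rewrite Hy in Hy'.
        change (f y - f q) with (f y + - f q). lra. }
      assert (HfR : Cmod (f q) <= eps / 4 * rad).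
      { apply Rle_trans with (eps / 4 * (Cmod (f q) / eps * 4))%R.
        - apply Req_le; field; lra.
        - apply Rmult_le_compat_l; [lra |]; unfold rad; lra. }
      apply Rmult_le_reg_r with (rad / 2)%R; [lra |].
      assert (HS := Cmod_ge_0 (slope f q l y)). nra. }
  assert (E : slope f q l z = 0).
  { apply Cmod_eq_0, Rle_antisym; [exact H0 | apply Cmod_ge_0]. }
  assert (E' := slope_mult f q l z). rewrite E, Cmult_0_l in E'.
  replace (f z) with (f z - f q + f q) by ring. rewrite <- E'; ring.
Qed.

(** * Automorphisms of the disc *)

Lemma disc_0 : disc 0.
Proof. unfold disc; rewrite Cmod_0; lra. Qed.

Lemma disc_opp (p : C) : disc p -> disc (- p).
Proof. unfold disc; rewrite Cmod_opp; auto. Qed.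

(** The slope [b z / z] has modulus at most [1 / r] on the circle of radius [r];
    let [r] tend to 1. *)
Lemma schwarz (b : C -> C) :
  (forall z, disc z -> C_differentiable b z) ->
  (forall z, disc z -> disc (b z)) -> b 0 = 0 ->
  forall z, disc z -> Cmod (b z) <= Cmod z.
Proof.
  intros HD Hb H0 z Hz.
  destruct (slope_continuous_base b 0 (HD 0 disc_0)) as [l Hl].
  assert (Hr : forall r, Cmod z < r < 1 -> r * Cmod (b z) <= Cmod z).
  { intros r Hr. assert (Hz0 := Cmod_ge_0 z).
    assert (H : Cmod (slope b 0 l z) <= / r).
    { apply (maximum_modulus_principle (slope b 0 l) (RtoC 0 :: nil) r); try lra.
      - intros y Hy; destruct (classic (y = 0)) as [-> | Hy0]; [exact Hl |].
        apply slope_continuous; [exact Hy0 |].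
        apply C_differentiable_continuous, HD; unfold disc; lra.
      - intros y Hy HyS; simpl in HyS; apply slope_differentiable; [intuition congruence |].
        apply HD; unfold disc; lra.
      - intros y Hy. apply Rmult_le_reg_r with r; [lra |].
        rewrite Rinv_l by lra. rewrite <- Hy at 1.
        replace y with (y - 0) at 2 by ring.
        rewrite <- Cmod_mult, slope_mult, H0.
        replace (b y - 0) with (b y) by ring.
        apply Rlt_le, Hb; unfold disc; lra. }
    assert (E := slope_mult b 0 l z). rewrite H0 in E.
    replace (b z) with (b z - 0) by ring. rewrite <- E, Cmod_mult.
    replace (z - 0) with z by ring.
    apply Rmult_le_compat_l with (r := r) in H; [| lra]. rewrite Rinv_r in H by lra. nra. }
  apply le_epsilon; intros eps He.
  (* Large enough that replacing [Cmod (b z)] by [r * Cmod (b z)] costs at most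
     [eps]. *)
  set (r := Rmax ((1 + Cmod z) / 2) (1 - eps)).
  unfold disc in Hz.
  assert (H1 := Rmax_l ((1 + Cmod z) / 2) (1 - eps)).
  assert (H2 := Rmax_r ((1 + Cmod z) / 2) (1 - eps)). fold r in H1, H2.
  assert (H3 : r < 1) by (apply Rmax_lub_lt; lra).
  specialize (Hr r ltac:(lra)). specialize (Hb z Hz). unfold disc in Hb.
  assert (H4 := Cmod_ge_0 (b z)). nra.
Qed.

(** The disc automorphism that moves [p] to 0; [Cmod (mobius p z)] is the
    pseudo-hyperbolic distance from [p] to [z]. *)
Definition mobius (p z : C) : C := (z - p) / (1 - Cconj p * z).

Lemma mobius_denominator (p z : C) : disc p -> disc z -> 1 - Cconj p * z <> 0.
Proof.
  intros Hp Hz; apply Cminus_neq_0; intros E.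
  assert (H := Cmod_1); rewrite E, Cmod_mult, Cmod_conj in H.
  unfold disc in *; assert (H1 := Cmod_ge_0 p); assert (H2 := Cmod_ge_0 z); nra.
Qed.

Lemma mobius_disc (p z : C) : disc p -> disc z -> disc (mobius p z).
Proof.
  intros Hp Hz; assert (Hd := mobius_denominator p z Hp Hz).
  unfold disc, mobius; rewrite Cmod_div by exact Hd.
  apply Cmod_gt_0 in Hd.
  apply Rmult_lt_reg_r with (1 := Hd). unfold Rdiv; rewrite Rmult_assoc, Rinv_l, Rmult_1_r,
    Rmult_1_l by lra.

  apply Rsqr_incrst_0; try apply Cmod_ge_0. rewrite !Rsqr_pow2.
  assert (E1 := Cmod2_alt p); assert (E2 := Cmod2_alt z).
  assert (E : (Cmod (1 - Cconj p * z) ^ 2 - Cmod (z - p) ^ 2 =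
          (1 - Cmod p ^ 2) * (1 - Cmod z ^ 2))%R).
  { rewrite E1, E2, !Cmod2_alt.
    unfold Re, Im, Cminus, Cplus, Copp, Cmult, Cconj, RtoC; cbn [fst snd]; ring. }
  assert (H1 := Cmod_ge_0 p); assert (H2 := Cmod_ge_0 z). unfold disc in Hp, Hz.
  assert (0 < (1 - Cmod p ^ 2) * (1 - Cmod z ^ 2))%R by (apply Rmult_lt_0_compat; nra).
  lra.
Qed.

Lemma mobius_differentiable (p z : C) :
  disc p -> disc z -> C_differentiable (mobius p) z.
Proof.
  intros Hp Hz; apply C_differentiable_div; [| | now apply mobius_denominator].
  - apply C_differentiable_minus; [apply C_differentiable_id | apply C_differentiable_const].
  - apply C_differentiable_minus; [apply C_differentiable_const |].
    apply C_differentiable_mult; [apply C_differentiable_const | apply C_differentiable_id].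
Qed.

Lemma mobius_opp_cancel (p z : C) :
  disc p -> disc z -> mobius (- p) (mobius p z) = z.
Proof.
  intros Hp Hz.
  assert (Hd := mobius_denominator p z Hp Hz).
  assert (Hd' := mobius_denominator p p Hp Hp).
  assert (Hd2 := mobius_denominator (- p) (mobius p z) (disc_opp p Hp) (mobius_disc p z Hp Hz)).
  unfold mobius in *. rewrite Copp_conj in *.
  assert (E : 1 - - Cconj p * ((z - p) / (1 - Cconj p * z)) =
     (1 - Cconj p * p) / (1 - Cconj p * z)) by (field; exact Hd).
  rewrite E. field; auto.
Qed.

Lemma mobius_base (p : C) : mobius p p = 0.
Proof. unfold mobius, Cminus; rewrite Cplus_opp_r; unfold Cdiv; ring. Qed.

(** Schwarz's lemma for [a] conjugated by the Moebius maps that move [p] and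
    [a p] to the origin. *)
Lemma schwarz_pick (a : C -> C) (p z : C) :
  (forall z, disc z -> C_differentiable a z) -> (forall z, disc z -> disc (a z)) ->
  disc p -> disc z ->
  Cmod (mobius (a p) (a z)) <= Cmod (mobius p z).
Proof.
  intros HD Ha Hp Hz.
  assert (Hp' := disc_opp p Hp).
  assert (H := schwarz (fun y => mobius (a p) (a (mobius (- p) y)))).
  rewrite <- (mobius_opp_cancel p z Hp Hz) at 1.
  apply H; clear H.
  - intros y Hy.
    apply (C_differentiable_comp (fun y => a (mobius (- p) y)) (mobius (a p))).
    + apply (C_differentiable_comp (mobius (- p)) a).
      * now apply mobius_differentiable.
      * now apply HD, mobius_disc.
    + now apply mobius_differentiable; [apply Ha | apply Ha, mobius_disc].
  - intros y Hy; apply mobius_disc; [now apply Ha |]. now apply Ha, mobius_disc.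
  - replace (mobius (- p) 0) with p; [apply mobius_base |].
    rewrite <- (mobius_base p); symmetry; now apply mobius_opp_cancel.
  - now apply mobius_disc.
Qed.

Definition disc_automorphism (a b : C -> C) : Prop :=
  (forall z, disc z -> C_differentiable a z /\ disc (a z) /\ b (a z) = z) /\
  (forall z, disc z -> C_differentiable b z /\ disc (b z) /\ a (b z) = z).

Lemma disc_automorphism_isometry (a b : C -> C) (p z : C) :
  disc_automorphism a b -> disc p -> disc z ->
  Cmod (mobius (a p) (a z)) = Cmod (mobius p z).
Proof.
  intros [Ha Hb] Hp Hz; apply Rle_antisym.
  - apply schwarz_pick; auto; intros y Hy; apply Ha, Hy.
  - destruct (Ha p Hp) as [_ [Hap Ep]]; destruct (Ha z Hz) as [_ [Haz Ez]].
    rewrite <- Ep at 1; rewrite <- Ez at 1.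
    apply schwarz_pick; auto; intros y Hy; apply Hb, Hy.
Qed.

Lemma mobius_automorphism (p : C) :
  disc p -> disc_automorphism (mobius p) (mobius (- p)).
Proof.
  intros Hp; assert (Hp' := disc_opp p Hp); split; intros z Hz; repeat split.
  - now apply mobius_differentiable.
  - now apply mobius_disc.
  - now apply mobius_opp_cancel.
  - now apply mobius_differentiable.
  - now apply mobius_disc.
  - generalize (mobius_opp_cancel (- p) z Hp' Hz).
    now replace (- - p) with p by ring.
Qed.

(** With [y], [z] on the circle of radius [d] about 0 and [c] their inner product,
    the hypothesis reads [2 d^2 - 2 c = d^2 (1 - 2 c + d^4)], which determines
    [c]. *)
Lemma equilateral_inner_product (y z : C) (d : R) :
  disc y -> disc z -> Cmod y = d -> Cmod z = d -> Cmod (mobius y z) = d ->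
  (2 * (Re y * Re z + Im y * Im z) = d ^ 2 * (1 + d ^ 2))%R.
Proof.
  intros Hy Hz Ey Ez E.
  assert (Hd := mobius_denominator y z Hy Hz).
  unfold mobius in E; rewrite Cmod_div in E by exact Hd.
  assert (Hd' := proj1 (Cmod_gt_0 _) Hd).
  assert (E' : (Cmod (z - y) ^ 2 = d ^ 2 * Cmod (1 - Cconj y * z) ^ 2)%R).
  { rewrite <- E; field; lra. }
  assert (Ey2 := Cmod2_alt y). assert (Ez2 := Cmod2_alt z). rewrite Ey in Ey2; rewrite Ez in Ez2.
  rewrite !Cmod2_alt in E'.
  assert (Hd1 : (d ^ 2 <> 1)%R).
  { unfold disc in Hy; rewrite Ey in Hy. assert (H := Cmod_ge_0 y). rewrite Ey in H. nra. }
  destruct y as [y1 y2], z as [z1 z2].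
  unfold Re, Im, Cminus, Cplus, Copp, Cmult, Cconj, RtoC in *; cbn [fst snd] in *.
  set (c := (y1 * z1 + y2 * z2)%R) in *.
  set (T := (d ^ 2)%R) in *.
  assert (L : ((z1 + - y1) ^ 2 + (z2 + - y2) ^ 2 = 2 * T - 2 * c)%R)
    by (unfold c; rewrite Ey2 at 1; nra).
  assert (N : ((1 + - (y1 * z1 - - y2 * z2)) ^ 2 + (- 0 + - (y1 * z2 + - y2 * z1)) ^ 2 =
     1 - 2 * c + T * T)%R).
  { unfold c; rewrite Ey2 at 1; rewrite Ez2; ring. }
  assert (E2 : (2 * T - 2 * c = T * (1 - 2 * c + T * T))%R).
  { rewrite <- L, <- N, E'. f_equal. ring. }
  apply Rmult_eq_reg_l with (1 - T)%R; [| lra]. lra.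
Qed.

(** Move [p0] to the origin.  The other three points become plane vectors with
    the same norm and the same pairwise inner products [c], where [c > 0].  Their
    Gram determinant is [(T - c)^2 (T + 2 c) > 0] with [T = d^2], whereas three
    vectors of the plane have Gram determinant 0. *)
Lemma no_equilateral_quadruple (p0 p1 p2 p3 : C) (d : R) :
  disc p0 -> disc p1 -> disc p2 -> disc p3 -> p0 <> p1 ->
  Cmod (mobius p0 p1) = d -> Cmod (mobius p0 p2) = d -> Cmod (mobius p0 p3) = d ->
  Cmod (mobius p1 p2) = d -> Cmod (mobius p1 p3) = d -> Cmod (mobius p2 p3) = d ->
  False.
Proof.
  intros H0 H1 H2 H3 Hne E01 E02 E03 E12 E13 E23.
  assert (Hm := mobius_automorphism p0 H0).
  rewrite <- (disc_automorphism_isometry _ _ p1 p2 Hm) in E12 by assumption.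
  rewrite <- (disc_automorphism_isometry _ _ p1 p3 Hm) in E13 by assumption.
  rewrite <- (disc_automorphism_isometry _ _ p2 p3 Hm) in E23 by assumption.
  assert (Hd0 : d <> 0%R).
  { intros ->. apply Hne. apply Cmod_eq_0 in E01.
    rewrite <- (mobius_opp_cancel p0 p0 H0 H0), <- (mobius_opp_cancel p0 p1 H0 H1).
    now rewrite E01, mobius_base. }
  assert (D1 := mobius_disc p0 p1 H0 H1). assert (D2 := mobius_disc p0 p2 H0 H2).
  assert (D3 := mobius_disc p0 p3 H0 H3).
  set (y1 := mobius p0 p1) in *. set (y2 := mobius p0 p2) in *. set (y3 := mobius p0 p3) in *.
  assert (I12 := equilateral_inner_product _ _ _ D1 D2 E01 E02 E12).
  assert (I13 := equilateral_inner_product _ _ _ D1 D3 E01 E03 E13).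
  assert (I23 := equilateral_inner_product _ _ _ D2 D3 E02 E03 E23).
  assert (N1 := Cmod2_alt y1). assert (N2 := Cmod2_alt y2). assert (N3 := Cmod2_alt y3).
  rewrite E01 in N1; rewrite E02 in N2; rewrite E03 in N3.
  unfold disc in D1; rewrite E01 in D1.
  assert (Hd : 0 <= d) by (rewrite <- E01; apply Cmod_ge_0).
  set (a1 := Re y1) in *; set (b1 := Im y1) in *; set (a2 := Re y2) in *;
  set (b2 := Im y2) in *; set (a3 := Re y3) in *; set (b3 := Im y3) in *.
  set (c12 := (a1 * a2 + b1 * b2)%R) in *. set (c13 := (a1 * a3 + b1 * b3)%R) in *.
  set (c23 := (a2 * a3 + b2 * b3)%R) in *.
  set (T := (d ^ 2)%R) in *.
  assert (HT : 0 < T < 1) by (unfold T; nra).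
  set (c := (T * (1 + T) / 2)%R).
  assert (J12 : c12 = c) by (unfold c; lra).
  assert (J13 : c13 = c) by (unfold c; lra).
  assert (J23 : c23 = c) by (unfold c; lra).
  (* The Gram determinant of three vectors in the plane. *)
  assert (G : (T * T * T + 2 * (c12 * c23 * c13) - T * c23 * c23
     - T * c13 * c13 - T * c12 * c12 = 0)%R).
  { transitivity ((a1 ^ 2 + b1 ^ 2) * (a2 ^ 2 + b2 ^ 2) * (a3 ^ 2 + b3 ^ 2)
      + 2 * (c12 * c23 * c13) - (a1 ^ 2 + b1 ^ 2) * c23 * c23
      - (a2 ^ 2 + b2 ^ 2) * c13 * c13 - (a3 ^ 2 + b3 ^ 2) * c12 * c12)%R.
    - rewrite <- N1, <- N2, <- N3; ring.
    - unfold c12, c13, c23; ring. }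
  rewrite J12, J13, J23 in G.
  assert (G' : ((T - c) * (T - c) * (T + 2 * c) = 0)%R) by (rewrite <- G; ring).
  assert (P1 : 0 < T - c) by (unfold c; nra).
  assert (P2 : 0 < T + 2 * c) by (unfold c; nra).
  assert (0 < (T - c) * (T - c) * (T + 2 * c))%R
    by (apply Rmult_lt_0_compat; [apply Rmult_lt_0_compat |]; assumption).
  lra.
Qed.

(** * Automorphisms of the plane *)

(** Consider [k z = z / (e z - e 0)].  It extends continuously to 0, being the
    slope of [g] at [e 0] evaluated at [e z].  Since [g] is bounded on the unit
    disc about [e 0], large [z] have [|e z - e 0| > 1], so [|k z| <= |z|].
    Then the slope of [k] at 1 is bounded, hence constant by Liouville's theorem,
    and [k] is affine.  As [k] cannot vanish off 0 and [e] is injective, [k] is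
    constant. *)
Theorem entire_automorphism_affine (e g : C -> C) :
  (forall z, C_differentiable e z) -> (forall z, C_differentiable g z) ->
  (forall z, g (e z) = z) ->
  exists c, forall z, c * (e z - e 0) = z.
Proof.
  intros De Dg Hge.
  destruct (slope_continuous_base g (e 0) (Dg _)) as [l Hl].
  set (k := fun z => slope g (e 0) l (e z)).
  assert (Hk : forall z, k z * (e z - e 0) = z).
  { intros z; unfold k; rewrite slope_mult, !Hge; ring. }
  assert (Ck : forall z, continuous k z).
  { intros z; apply (continuous_comp e (slope g (e 0) l));
      [now apply C_differentiable_continuous |].
    destruct (classic (e z = e 0)) as [-> | Hz]; [exact Hl |].
    apply slope_continuous; [exact Hz | now apply C_differentiable_continuous]. }
  assert (Dk : forall z : C, z <> 0 -> C_differentiable k z).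
  { intros z Hz; apply (C_differentiable_comp e (slope g (e 0) l)); [apply De |].
    apply slope_differentiable; [| apply Dg].
    intros E; apply Hz; rewrite <- (Hge z), E; apply Hge. }
  destruct (continuous_bounded_above (fun y => Cmod (g (y + e 0))) 1) as [B HB]; [lra | |].
  { intros y _; apply continuous_Cmod.
    apply (continuous_comp (fun y => y + e 0) g).
    - apply continuous_Cplus; [apply continuous_id | apply continuous_const].
    - now apply C_differentiable_continuous. }
  assert (Gk : forall z, B < Cmod z -> Cmod (k z) <= Cmod z).
  { intros z Hz.
    assert (H1 : 1 < Cmod (e z - e 0)).
    { apply Rnot_le_lt; intros H; apply HB in H.
      replace (e z - e 0 + e 0) with (e z) in H by ring. rewrite Hge in H; lra. }
    rewrite <- (Hk z) at 2. rewrite Cmod_mult.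
    assert (H2 := Cmod_ge_0 (k z)). nra. }
  assert (C1_neq_0 : RtoC 1 <> 0) by (intros E; apply RtoC_inj in E; lra).
  destruct (slope_continuous_base k 1 (Dk 1 C1_neq_0)) as [l' Hl'].
  assert (Hm : forall z w, slope k 1 l' z = slope k 1 l' w).
  { apply liouville_sublinear with (S := RtoC 0 :: RtoC 1 :: nil).
    - intros z; destruct (classic (z = RtoC 1)) as [-> | Hz]; [exact Hl' |].
      apply slope_continuous; auto.
    - intros z Hz; simpl in Hz; apply slope_differentiable; [| apply Dk]; intuition congruence.
    - intros eps He.
      set (M := (2 + 2 * Cmod (k 1))%R).
      exists (Rmax (Rmax (B + 1) 2) (M / eps)); intros z Hz.
      assert (H1 := Rle_trans _ _ _ (Rmax_l _ _) Hz).
      assert (H2 := Rle_trans _ _ _ (Rmax_r _ _) Hz).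
      assert (H3 := Rle_trans _ _ _ (Rmax_l _ _) H1).
      assert (H4 := Rle_trans _ _ _ (Rmax_r _ _) H1).
      apply Rle_div_l in H2; [| exact He].
      apply Rle_trans with M; [| lra].
      assert (Hk1 := Cmod_ge_0 (k 1)).
      assert (T := Cmod_minus_ge z 1). rewrite Cmod_1 in T.
      assert (Gz := Gk z ltac:(lra)).
      assert (E : (Cmod (slope k 1 l' z) * Cmod (z - 1) <= Cmod z + Cmod (k 1))%R).
      { rewrite <- Cmod_mult, slope_mult.
        apply Rle_trans with (1 := Cmod_triangle (k z) (- k 1)). rewrite Cmod_opp; lra. }
      assert (Hs := Cmod_ge_0 (slope k 1 l' z)).
      assert (Cmod (slope k 1 l' z) * (Cmod z / 2) <= M * (Cmod z / 2))%R
        by (unfold M; nra).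
      apply Rmult_le_reg_r with (Cmod z / 2)%R; lra. }
  set (c := slope k 1 l' 0).
  assert (Ek : forall z, k z = k 1 + c * (z - 1)).
  { intros z; unfold c; rewrite (Hm 0 z), slope_mult; ring. }
  destruct (classic (c = 0)) as [Hc | Hc].
  { exists (k 1); intros z. rewrite <- (Hk z) at 2. rewrite (Ek z), Hc; ring. }
  exfalso.
  (* The zero of the affine function [k] must be 0, so [k z = c z] and
     [e z - e 0] would take the value [1 / c] both at 1 and at 2. *)
  set (z0 := 1 - k 1 / c).
  assert (Ez0 : k z0 = 0) by (rewrite Ek; unfold z0; field; exact Hc).
  assert (Hz0 : z0 = 0) by (rewrite <- (Hk z0), Ez0; ring).
  assert (Ek1 : k 1 = c).
  { replace (k 1) with (c - c * z0) by (unfold z0; field; exact Hc). rewrite Hz0; ring. }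
  assert (H1 := Hk 1). assert (H2 := Hk 2). rewrite Ek, Ek1 in H1, H2.
  assert (E1 : e 1 = e 0 + / c).
  { replace (e 1) with (e 0 + / c * ((c + c * (1 - 1)) * (e 1 - e 0))) by (field; exact Hc).
    rewrite H1; ring. }
  assert (E2 : e 2 = e 0 + / c).
  { replace (e 2) with (e 0 + / c * (/ 2 * ((c + c * (2 - 1)) * (e 2 - e 0))))
      by (field; exact Hc).
    rewrite H2; field; exact Hc. }
  assert (E : e 1 = e 2) by congruence.
  apply (f_equal g) in E. rewrite !Hge in E. apply RtoC_inj in E; lra.
Qed.

(** * Automorphisms of the product *)

(** A [C]-linear map of [C] is multiplication by its value at 1, which is the
    limit of the difference quotients. *)
Lemma ex_filterdiff_C_differentiable (f : C -> C) (a : C) :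
  ex_filterdiff (f : C_NormedModule -> C_NormedModule) (locally a) ->
  C_differentiable f a.
Proof.
  intros [l [Hlin Hdom]].
  assert (Hl : forall h : C, l h = h * l (RtoC 1)).
  { intros h; transitivity (l (scal h (RtoC 1 : C_NormedModule)));
      [| apply (linear_scal l Hlin)].
    f_equal; unfold scal; simpl; unfold mult; simpl; cring. }
  exists (slope f a (l (RtoC 1))); split.
  2: { apply filter_forall; intros z; symmetry; apply slope_mult. }
  assert (Ha : slope f a (l (RtoC 1)) a = l (RtoC 1)).
  { unfold slope; destruct excluded_middle_informative; congruence. }
  apply continuous_Cmod_iff; intros eps He; rewrite Ha.
  assert (He2 : 0 < eps / 2) by lra.
  specialize (Hdom a (fun P HP => HP) (mkposreal _ He2)).
  apply filter_imp with (2 := Hdom); clear Hdom.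
  intros z Hz.
  change (Cmod (f z - f a - l (z - a)) <= eps / 2 * Cmod (z - a)) in Hz.
  rewrite Hl, <- (slope_mult f a (l (RtoC 1)) z) in Hz.
  replace (slope f a (l (RtoC 1)) z * (z - a) - (z - a) * l (RtoC 1))
    with ((slope f a (l (RtoC 1)) z - l (RtoC 1)) * (z - a)) in Hz by cring.
  rewrite Cmod_mult in Hz.
  destruct (classic (z = a)) as [-> | Hza].
  - rewrite Ha. unfold Cminus; rewrite Cplus_opp_r, Cmod_0; exact He.
  - assert (Hp := proj1 (Cmod_gt_0 _) (Cminus_neq_0 z a Hza)).
    apply Rmult_le_reg_r in Hz; lra.
Qed.

Lemma is_linear_scal_C {V : NormedModule C_AbsRing} (v : V) :
  is_linear (fun t : C_NormedModule => scal (t : C) v).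
Proof.
  split.
  - intros x y; apply (scal_distr_r (x : C_AbsRing) y v).
  - intros k x; symmetry; apply (scal_assoc (k : C_AbsRing) x v).
  - assert (Hv := norm_ge_0 v).
    exists (norm v + 1)%R; split; [lra |]; intros x.
    apply Rle_trans with (1 := norm_scal (x : C_AbsRing) v).
    change (Cmod x * norm v <= (norm v + 1) * Cmod x).
    assert (H := Cmod_ge_0 x); nra.
Qed.

Lemma C_differentiable_line (F : C2 -> C2) (L : C2 -> C_NormedModule) (p v : C2) (t : C) :
  is_linear L -> ex_filterdiff F (locally (plus p (scal t v))) ->
  C_differentiable (fun t => L (F (plus p (scal t v)))) t.
Proof.
  intros HL [dF HF]; apply ex_filterdiff_C_differentiable.
  set (line := fun t : C_NormedModule => plus p (scal t v)).
  assert (Hline : filterdiff line (locally t) (fun t => scal t v)).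
  { apply filterdiff_ext_lin with (l1 := fun t : C_NormedModule => plus zero (scal t v)).
    - apply (filterdiff_plus_fct (fun _ => p) (fun t : C_NormedModule => scal t v)
        (fun _ => zero) (fun t : C_NormedModule => scal t v)); [apply filterdiff_const |].
      apply filterdiff_linear, is_linear_scal_C.
    - intros y; apply plus_zero_l. }
  eexists. apply (filterdiff_comp (fun t => F (line t)) L).
  - apply (filterdiff_comp line F); [exact Hline |].
    apply filterdiff_locally with (x := line t); [| exact HF].
    apply (filterdiff_continuous line); eexists; exact Hline.
  - apply filterdiff_linear, HL.
Qed.

Lemma horizontal_slice_differentiable (F : C2 -> C2) (L : C2 -> C_NormedModule) (z w : C) :
  is_linear L -> ex_filterdiff F (locally ((z, w) : C2)) ->
  C_differentiable (fun z => L (F (z, w))) z.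
Proof.
  intros HL HF.
  assert (E : forall t : C, plus ((RtoC 0, w) : C2) (scal t ((RtoC 1, RtoC 0) : C2)) = (t, w)).
  { intros t; apply injective_projections;
      [change (0 + t * 1 = t) | change (w + t * 0 = w)]; ring. }
  apply C_differentiable_ext_loc with (2 := C_differentiable_line F L
    ((RtoC 0, w) : C2) ((RtoC 1, RtoC 0) : C2) z HL ltac:(now rewrite E)).
  apply filter_forall; intros t; now rewrite E.
Qed.

Lemma vertical_slice_differentiable (F : C2 -> C2) (L : C2 -> C_NormedModule) (z w : C) :
  is_linear L -> ex_filterdiff F (locally ((z, w) : C2)) ->
  C_differentiable (fun w => L (F (z, w))) w.
Proof.
  intros HL HF.
  assert (E : forall t : C, plus ((z, RtoC 0) : C2) (scal t ((RtoC 0, RtoC 1) : C2)) = (z, t)).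
  { intros t; apply injective_projections;
      [change (z + t * 0 = z) | change (0 + t * 1 = t)]; ring. }
  apply C_differentiable_ext_loc with (2 := C_differentiable_line F L
    ((z, RtoC 0) : C2) ((RtoC 0, RtoC 1) : C2) w HL ltac:(now rewrite E)).
  apply filter_forall; intros t; now rewrite E.
Qed.

(** Liouville's theorem along the fibre, where the first coordinate stays in the
    unit disc. *)
Lemma first_coordinate_fibrewise_constant (F : C2 -> C2) (z w w' : C) :
  holomorphic_on disc_times_C F -> (forall p, disc_times_C p -> disc_times_C (F p)) ->
  disc z -> fst (F (z, w)) = fst (F (z, w')).
Proof.
  intros HF HX Hz.
  assert (HD : forall w, C_differentiable (fun w => fst (F (z, w))) w).
  { intros y; apply (vertical_slice_differentiable F fst); [apply is_linear_fst |].
    now apply HF. }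
  apply (liouville_sublinear (fun w => fst (F (z, w))) nil).
  - intros y; now apply C_differentiable_continuous.
  - intros y _; apply HD.
  - intros eps He; exists (/ eps)%R; intros y Hy.
    apply Rle_trans with 1.
    + apply Rlt_le, (HX (z, y)), Hz.
    + apply Rmult_le_compat_l with (r := eps) in Hy; [| lra].
      rewrite Rinv_r in Hy; lra.
Qed.

Lemma automorphism_base (F : C2 -> C2) :
  automorphism disc_times_C F ->
  exists a b, disc_automorphism a b /\
    forall z w : C, disc z -> fst (F (z, w)) = a z.
Proof.
  intros [HF [FX [G [HG [GX [HGF HFG]]]]]].
  assert (cF := fun z w w' => first_coordinate_fibrewise_constant F z w w' HF FX).
  assert (cG := fun z w w' => first_coordinate_fibrewise_constant G z w w' HG GX).
  exists (fun z => fst (F (z, RtoC 0))), (fun z => fst (G (z, RtoC 0))).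
  split; [split |]; [| | intros z w Hz; now apply cF]; intros z Hz; repeat split.
  - apply (horizontal_slice_differentiable F fst); [apply is_linear_fst | now apply HF].
  - now apply (FX (z, RtoC 0)).
  - rewrite (cG _ _ (snd (F (z, RtoC 0)))) by now apply (FX (z, RtoC 0)).
    rewrite <- surjective_pairing, HGF; [reflexivity | exact Hz].
  - apply (horizontal_slice_differentiable G fst); [apply is_linear_fst | now apply HG].
  - now apply (GX (z, RtoC 0)).
  - rewrite (cF _ _ (snd (G (z, RtoC 0)))) by now apply (GX (z, RtoC 0)).
    rewrite <- surjective_pairing, HFG; [reflexivity | exact Hz].
Qed.

(** The fibre over [z] is preserved because the base map fixes [z], and an affine
    map of [C] with two fixed points is the identity. *)
Lemma automorphism_fibre_rigid (F : C2 -> C2) (z w0 w1 w : C) :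
  automorphism disc_times_C F -> disc z -> w0 <> w1 ->
  F (z, w0) = (z, w0) -> F (z, w1) = (z, w1) -> F (z, w) = (z, w).
Proof.
  intros HA Hz Hne H0 H1.
  destruct (automorphism_base F HA) as [a [_ [_ Ha]]].
  assert (Haz : a z = z) by (rewrite <- (Ha z w0 Hz), H0; reflexivity).
  destruct HA as [HF [FX [G [HG [GX [HGF HFG]]]]]].
  assert (EF : forall y, F (z, y) = (z, snd (F (z, y)))).
  { intros y; apply injective_projections; [| reflexivity].
    transitivity (a z); [apply (Ha z y Hz) | exact Haz]. }
  set (e := fun y : C => snd (F (z, y)) : C).
  destruct (entire_automorphism_affine e (fun y => snd (G (z, y)))) as [c Hc].
  - intros y; apply (vertical_slice_differentiable F snd); [apply is_linear_snd | now apply HF].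
  - intros y; apply (vertical_slice_differentiable G snd); [apply is_linear_snd | now apply HG].
  - intros y; unfold e; rewrite <- EF, HGF; [reflexivity | exact Hz].
  - assert (E0 := Hc w0); assert (E1 := Hc w1).
    replace (e w0) with w0 in E0 by (unfold e; now rewrite H0).
    replace (e w1) with w1 in E1 by (unfold e; now rewrite H1).
    assert (Hd := Cminus_neq_0 w0 w1 Hne).
    assert (Hc1 : c = 1).
    { replace c with ((c * (w0 - e 0) - c * (w1 - e 0)) / (w0 - w1)) by (field; exact Hd).
      rewrite E0, E1; field; exact Hd. }
    rewrite Hc1 in Hc, E0.
    assert (E : e w = w).
    { replace (e w) with (1 * (e w - e 0) + w0 - 1 * (w0 - e 0)) by ring.
      rewrite Hc, E0; ring. }
    rewrite EF; f_equal; exact E.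
Qed.

(** * Prescribing values at finitely many points *)

Lemma Finite_subset_of_list {T : Type} (l : list T) (D : T -> Prop) :
  (forall x, D x -> In x l) -> Finite_sets.Finite T D.
Proof.
  revert D; induction l as [| a l IH]; intros D HD.
  - replace D with (Ensembles.Empty_set T); [constructor |].
    apply functional_extensionality; intros x; apply propositional_extensionality.
    split; [intros [] | intros Hx; destruct (HD x Hx)].
  - destruct (classic (D a)) as [Ha | Ha].
    + replace D with (Ensembles.Add T (fun x => D x /\ x <> a) a).
      * apply Finite_sets.Union_is_finite; [| intros [_ H]; now apply H].
        apply IH; intros x [Hx Hxa]; destruct (HD x Hx) as [E | Hin]; [congruence | exact Hin].
      * apply functional_extensionality; intros x; apply propositional_extensionality.
        split.
        -- intros [y [Hy _] | y Hy]; [exact Hy | destruct Hy; exact Ha].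
        -- intros Hx; destruct (classic (x = a)) as [-> | Hxa];
             [right; constructor | left; split; assumption].
    + apply IH; intros x Hx; destruct (HD x Hx) as [<- | Hin]; [contradiction | exact Hin].
Qed.

Lemma infinite_fresh_element {T : Type} (D : T -> Prop) (l : list T) :
  ~ Finite_sets.Finite T D -> exists x, D x /\ ~ In x l.
Proof.
  intros HD; apply NNPP; intros H; apply HD, (Finite_subset_of_list l).
  intros x Hx; apply NNPP; intros Hx'; apply H; exists x; auto.
Qed.

Definition swap {T : Type} (x y p : T) : T :=
  if excluded_middle_informative (p = x) then y
  else if excluded_middle_informative (p = y) then x else p.

Lemma swap_involutive {T : Type} (x y p : T) : swap x y (swap x y p) = p.
Proof.
  unfold swap; repeat destruct excluded_middle_informative; congruence.
Qed.

Lemma swap_stable {T : Type} (D : T -> Prop) (x y p : T) :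
  D x -> D y -> D p -> D (swap x y p).
Proof.
  intros; unfold swap; repeat destruct excluded_middle_informative; assumption.
Qed.

Lemma swap_l {T : Type} (x y : T) : swap x y x = y.
Proof. unfold swap; destruct excluded_middle_informative; congruence. Qed.

Lemma swap_r {T : Type} (x y : T) : swap x y y = x.
Proof. unfold swap; repeat destruct excluded_middle_informative; congruence. Qed.

Lemma swap_other {T : Type} (x y p : T) : p <> x -> p <> y -> swap x y p = p.
Proof. intros; unfold swap; repeat destruct excluded_middle_informative; congruence. Qed.

Lemma swap_injective {T : Type} (x y p q : T) : swap x y p = swap x y q -> p = q.
Proof.
  intros E; rewrite <- (swap_involutive x y p), E; apply swap_involutive.
Qed.

(** After the transposition that takes [p] to [r], a second one takes the image of
    [q] to [s]; it leaves [r] alone because [p <> q] and [r <> s]. *)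
Lemma strongly_tame_two_transitive {U : NormedModule C_AbsRing} (X D : U -> Prop)
    (p q r s : U) :
  strongly_tame X D -> D p -> D q -> D r -> D s -> p <> q -> r <> s ->
  exists phi, automorphism X phi /\ phi p = r /\ phi q = s.
Proof.
  intros [_ [_ H]] Hp Hq Hr Hs Hpq Hrs.
  destruct (H (fun x => swap (swap p r q) s (swap p r x))) as [phi [Hphi E]].
  - intros x Hx; repeat apply swap_stable; assumption.
  - intros x y _ _ Exy; now do 2 apply swap_injective in Exy.
  - exists phi; split; [exact Hphi |]; rewrite !E by assumption; split.
    + rewrite swap_l; apply swap_other; [| exact Hrs].
      intros Er; apply Hpq. apply (swap_injective p r). now rewrite swap_l.
    + apply swap_l.
Qed.

Lemma strongly_tame_transposition {U : NormedModule C_AbsRing} (X D : U -> Prop) (r s : U) :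
  strongly_tame X D -> D r -> D s ->
  exists phi, automorphism X phi /\ phi r = s /\
    forall p, D p -> p <> r -> p <> s -> phi p = p.
Proof.
  intros [_ [_ H]] Hr Hs.
  destruct (H (swap r s)) as [phi [Hphi E]].
  - intros x Hx; apply swap_stable; assumption.
  - intros x y _ _; apply swap_injective.
  - exists phi; split; [exact Hphi |]; split.
    + rewrite E by exact Hr; apply swap_l.
    + intros p Hp Hpr Hps; rewrite E by exact Hp; now apply swap_other.
Qed.

Theorem proposition5p3 :
  ~ exists D : C2 -> Prop, strongly_tame disc_times_C D.
Proof.
  intros [D HD].
  assert (HX : forall p, D p -> disc (fst p)) by (intros p Hp; now apply (proj1 (proj1 HD))).
  assert (Hinf := proj1 (proj2 HD)).
  destruct (infinite_fresh_element D nil Hinf) as [p0 [D0 _]].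
  destruct (infinite_fresh_element D (p0 :: nil) Hinf) as [p1 [D1 N1]].
  destruct (infinite_fresh_element D (p0 :: p1 :: nil) Hinf) as [p2 [D2 N2]].
  destruct (infinite_fresh_element D (p0 :: p1 :: p2 :: nil) Hinf) as [p3 [D3 N3]].
  simpl in N1, N2, N3.
  destruct (classic (exists p q, D p /\ D q /\ p <> q /\ fst p = fst q))
    as [[p [q [Dp [Dq [Hpq Efst]]]]] | Hno].
  - assert (Hfibre : forall r s, D r -> D s -> fst r = fst s).
    { intros r s Dr Ds; destruct (classic (r = s)) as [-> | Hrs]; [reflexivity |].
      destruct (strongly_tame_two_transitive disc_times_C D p q r s) as [phi [Hphi [<- <-]]];
        try assumption.
      destruct (automorphism_base phi Hphi) as [a [_ [_ Ha]]].
      rewrite (surjective_pairing p), (surjective_pairing q), !Ha by auto.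
      now rewrite Efst. }
    destruct (strongly_tame_transposition disc_times_C D p2 p3) as [phi [Hphi [E23 Efix]]];
      try assumption.
    assert (E0 := Efix p0 D0 ltac:(intuition congruence) ltac:(intuition congruence)).
    assert (E1 := Efix p1 D1 ltac:(intuition congruence) ltac:(intuition congruence)).
    assert (F1 := Hfibre p1 p0 D1 D0). assert (F2 := Hfibre p2 p0 D2 D0).
    specialize (HX p0 D0).
    destruct p0 as [z w0], p1 as [z1 w1], p2 as [z2 w2]; simpl in F1, F2, HX; subst z1 z2.
    apply N3; right; right; left; rewrite <- E23; symmetry.
    apply (automorphism_fibre_rigid phi z w0 w1 w2 Hphi HX); [| exact E0 | exact E1].
    intros ->; apply N1; now left.
  - assert (Hinj : forall p q, D p -> D q -> p <> q -> fst p <> fst q).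
    { intros p q Dp Dq Hpq E; apply Hno; exists p, q; auto. }
    assert (Hdist : forall r s, D r -> D s -> r <> s ->
      Cmod (mobius (fst r) (fst s)) = Cmod (mobius (fst p0) (fst p1))).
    { intros r s Dr Ds Hrs.
      destruct (strongly_tame_two_transitive disc_times_C D p0 p1 r s)
        as [phi [Hphi [<- <-]]]; try assumption; [intuition congruence |].
      destruct (automorphism_base phi Hphi) as [a [b [Hab Ha]]].
      rewrite (surjective_pairing p0) at 1; rewrite (surjective_pairing p1) at 1.
      rewrite !Ha by auto.
      apply (disc_automorphism_isometry a b); auto. }
    apply (no_equilateral_quadruple (fst p0) (fst p1) (fst p2) (fst p3)
      (Cmod (mobius (fst p0) (fst p1)))); auto; try (apply Hinj || apply Hdist);
      try assumption; intuition congruence.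
Qed.
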